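(* Let $\mathcal{T}$ be a self-affine tiling of $\mathbb{R}^d$ with expansion map $Q$ and a primitive substitution rule with finite local complexity, where $Q$ is diagonalizable over $\mathbb{C}$ and all eigenvalues of $Q$ are algebraic conjugates of one another with the same multiplicity, and assume the set $\operatorname{spec}(Q)$ of eigenvalues of $Q$ is a Pisot family. Then for every finite $\mathcal{T}$-legal patch $\mathcal{P}$ and every $n>0$ there is a basis $\{b_1,\dots,b_d\}$ of $\mathbb{R}^d$ such that the patch $\bigcup_{(l_1,\dots,l_d)\in\{1,\dots,n\}^d}\left(\mathcal{P}+\sum_{j=1}^d l_jb_j\right)$ is $\mathcal{T}$-legal.
   Context: A tile in $\mathbb{R}^d$ is a compact set equal to the closure of its interior, possibly labeled from a finite set. Patches: sets of tiles with pairwise disjoint interiors; tilings: patches with support $\mathbb{R}^d$; $\mathcal{P}$ is $\mathcal{T}$-legal if $\mathcal{P}+y\subset\mathcal{T}$ for some $y$. $\mathcal{P}\sqcap S=\{T\in\mathcal{P}:\operatorname{supp}T\cap S\neq\emptyset\}$. Substitution rule: finite prototile set $\mathcal{A}$, linear $Q$ with all eigenvalues of modulus $>1$, map $\omega$ sending $P\in\mathcal{A}$ to a finite patch of translates of prototiles with $\operatorname{supp}\omega(P)=Q(\operatorname{supp}P)$, extended by $\omega(P+x)=\omega(P)+Qx$ and unions; primitive if some power of the substitution matrix is positive; FLC if $\{\omega^n(P)\sqcap(K+x)\}_{n>0,P,x}$ is finite up to translation for each compact $K$. A self-affine tiling for $\omega$ is a tiling $\mathcal{T}$ of translates of prototiles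 with $\omega(\mathcal{T})=\mathcal{T}$, having finite local complexity and being repetitive (each finite legal patch occurs as a translate in every ball of some fixed radius). A set $\Lambda$ of algebraic integers is a Pisot family if for every $\lambda\in\Lambda$ and every algebraic conjugate $\mu$ of $\lambda$ with $|\mu|\ge1$ we have $\mu\in\Lambda$. *)

(* Defs.v *)
From mathcomp Require Import all_boot all_order all_algebra.
From mathcomp Require Import all_classical all_reals all_analysis.
From mathcomp Require Import complex.
Import GRing.Theory Num.Theory numFieldTopology.Exports numFieldNormedType.Exports.

Set Implicit Arguments.
Unset Strict Implicit.
Unset Printing Implicit Defensive.

Local Open Scope ring_scope.
Local Open Scope classical_set_scope.

Section Tilings.
Context {R : realType} {d : nat}.
Local Notation V := 'rV[R]_d.

Record tile := Tile { tlab : nat; tsupp : set V }.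

Definition is_tile (T : tile) : Prop :=
  compact (tsupp T) /\ closure (interior (tsupp T)) = tsupp T.

Definition tile_tr (T : tile) (x : V) : tile :=
  Tile (tlab T) ((fun y => y + x) @` tsupp T).

Definition patch_tr (P : set tile) (x : V) : set tile :=
  (fun T => tile_tr T x) @` P.

Definition patch_supp (P : set tile) : set V := \bigcup_(T in P) tsupp T.

Definition is_patch (P : set tile) : Prop :=
  (forall T, P T -> is_tile T) /\
  (forall T T', P T -> P T' -> T <> T' ->
     interior (tsupp T) `&` interior (tsupp T') = set0).

Definition is_tiling (P : set tile) : Prop :=
  is_patch P /\ patch_supp P = setT.

Definition legal (Tg P : set tile) : Prop :=
  exists y : V, patch_tr P y `<=` Tg.

Definition patch_meet (P : set tile) (S : set V) : set tile :=
  [set T | P T /\ (tsupp T `&` S !=set0)].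

Definition fin_up_to_tr (F : set (set tile)) : Prop :=
  exists (N : nat) (G : nat -> set tile),
    forall P, F P -> exists (k : nat) (x : V), (k < N)%N /\ P = patch_tr (G k) x.

(* the linear map x |-> Q x (points of R^d are row vectors) *)
Definition linQ (Q : 'M[R]_d) (x : V) : V := x *m Q^T.

Definition mxC (Q : 'M[R]_d) : 'M[R[i]]_d := map_mx (fun x : R => (x%:C)%C) Q.
Definition spec (Q : 'M[R]_d) : set R[i] := [set z | eigenvalue (mxC Q) z].
Definition expanding (Q : 'M[R]_d) : Prop := forall z, spec Q z -> 1 < `|z|.

(* A substitution rule with prototiles indexed by 'I_m:
   omega i lists the pairs (j, y) such that proto j + y is a tile of omega(proto i). *)
Record subst_rule (m : nat) := SubstRule {
  proto : 'I_m -> tile;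
  expo : 'M[R]_d;
  omega : 'I_m -> seq ('I_m * V) }.

Context {m : nat}.

Definition omega_patch (S : subst_rule m) (i : 'I_m) : set tile :=
  [set T | exists2 p, p \in omega S i & T = tile_tr (proto S p.1) p.2].

(* omega extended to patches of translates of prototiles:
   omega(P + x) = omega(P) + Q x, and omega commutes with unions *)
Definition subst_apply (S : subst_rule m) (P : set tile) : set tile :=
  [set T' | exists (i : 'I_m) (x : V) (p : 'I_m * V),
     [/\ P (tile_tr (proto S i) x), p \in omega S i &
         T' = tile_tr (proto S p.1) (p.2 + linQ (expo S) x)]].

Definition is_subst (S : subst_rule m) : Prop :=
  [/\ forall i, is_tile (proto S i),
      forall i j x, proto S i = tile_tr (proto S j) x -> i = j,
      expanding (expo S) &
      forall i, [/\ uniq (omega S i), is_patch (omega_patch S i) &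
                  patch_supp (omega_patch S i) = linQ (expo S) @` tsupp (proto S i)]].

Definition subst_mx (S : subst_rule m) : 'M[int]_m :=
  \matrix_(i, j) ((count (fun p : 'I_m * V => p.1 == i) (omega S j))%:Z).

Definition primitive (S : subst_rule m) : Prop :=
  exists k : nat, (0 < k)%N /\ forall i j, 0 < (subst_mx S ^+ k) i j.

Definition subst_FLC (S : subst_rule m) : Prop :=
  forall K : set V, compact K ->
    fin_up_to_tr [set P | exists (n : nat) (i : 'I_m) (x : V),
      (0 < n)%N /\ P = patch_meet (iter n (subst_apply S) [set proto S i])
                                  ((fun y => y + x) @` K)].

Definition tiling_FLC (Tg : set tile) : Prop :=
  forall K : set V, compact K ->
    fin_up_to_tr [set P | exists x : V, P = patch_meet Tg ((fun y => y + x) @` K)].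

Definition repetitive (Tg : set tile) : Prop :=
  forall P : set tile, finite_set P -> legal Tg P ->
    exists r : R, 0 < r /\ forall x : V, exists y : V,
      patch_tr P y `<=` Tg /\ patch_supp (patch_tr P y) `<=` ball x r.

Definition self_affine_tiling (S : subst_rule m) (Tg : set tile) : Prop :=
  [/\ is_tiling Tg,
      forall T, Tg T -> exists (i : 'I_m) (x : V), T = tile_tr (proto S i) x,
      subst_apply S Tg = Tg,
      tiling_FLC Tg &
      repetitive Tg].

End Tilings.

Section Algebraic.
Context {R : realType}.

Definition alg_int (z : R[i]) : Prop :=
  exists p : {poly int}, p \is monic /\ root (map_poly intr p) z.

(* w is an algebraic conjugate of the algebraic number z: w is a root of the
   minimal polynomial of z over Q, i.e. z is algebraic and every rational
   polynomial vanishing at z vanishes at w *)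
Definition alg_conj (z w : R[i]) : Prop :=
  (exists q : {poly rat}, q != 0 /\ root (map_poly ratr q) z) /\
  (forall q : {poly rat}, root (map_poly ratr q) z -> root (map_poly ratr q) w).

Definition pisot_family (L : set R[i]) : Prop :=
  forall l, L l -> alg_int l /\
    (forall mu, alg_conj l mu -> 1 <= `|mu| -> L mu).

End Algebraic.

(* Main.v *)
(** Attach to every tile a control point so that the set X of control points
    satisfies Q X c X.  The rational span of X - X has a finite basis E on
    which Q acts by a rational matrix B annihilated by the minimal polynomial
    of the eigenvalues of Q, so B is diagonalizable and all its eigenvalues
    have the same multiplicity.

    Rigidity: for an eigenvalue theta of maximal modulus, an eigenfunctional l
    of B satisfies l(Qx) - l(Qy) = theta (l x - l y) on X and is Lipschitz for
    the Euclidean seminorm given by the eigenvectors of Q of top modulus.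
    Along a long, almost extremal segment of X a function with optimal
    Lipschitz constant is almost affine near the midpoint, and by repetitivity
    every finite part of X occurs there; hence l is linear on X - X.  Thus the
    multiplicities of theta in B and Q agree, and then so do those of all its
    conjugates in spec Q.  By the Pisot family property every other eigenvalue
    of B is contracting, and contracted functionals are bounded on X.

    Consequently, taking a lattice W spanned by vectors Q^k v with k large, the
    differences between points of X and nearby lattice points of a prescribed
    finite set take finitely many values, independently of that set.  Colouring
    lattice points by these differences, Gallai's theorem gives a
    monochromatic homothetic copy of {1,...,n}^d, which is the required
    configuration of translates of the patch. *)
Require Import Defs.
From mathcomp Require Import all_boot all_order all_algebra.
From mathcomp Require Import all_classical all_reals all_analysis.
From mathcomp Require Import complex.
From mathcomp Require Import separable.
From mathcomp Require Import ring lra.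
Import Order.TTheory GRing.Theory Num.Theory numFieldTopology.Exports numFieldNormedType.Exports.
Set Implicit Arguments.
Unset Strict Implicit.
Unset Printing Implicit Defensive.
Local Open Scope ring_scope.
Local Open Scope classical_set_scope.
Local Notation Re := complex.Re.
Local Notation Im := complex.Im.

(** * Real-valued modulus on the complex numbers and elementary bounds *)

Section Modulus.
Context {R : realType}.
Implicit Types z w : R[i].

(** The norm on [R[i]] takes values in [R[i]]; this real copy allows ordered-field reasoning over
    [R]. *)
Definition cabs z : R := ComplexField.Normc.normc z.

Lemma cabsE z : `|z| = (cabs z)%:C%C. Proof. by []. Qed.

Lemma cabs_ge0 z : 0 <= cabs z.
Proof. by have := normr_ge0 z; rewrite cabsE ler0c. Qed.

Lemma cabsM z w : cabs (z * w) = cabs z * cabs w.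
Proof. exact: ComplexField.Normc.normcM. Qed.

Lemma cabs0 : cabs 0 = 0.
Proof. exact: ComplexField.Normc.normc0. Qed.

Lemma cabs1 : cabs 1 = 1.
Proof. exact: ComplexField.Normc.normc1. Qed.

Lemma cabsD z w : cabs (z + w) <= cabs z + cabs w.
Proof. exact: le_normcD. Qed.

Lemma cabsN z : cabs (- z) = cabs z.
Proof. exact: normcN. Qed.

Lemma cabsV z : cabs z^-1 = (cabs z)^-1.
Proof. exact: ComplexField.Normc.normcV. Qed.

Lemma cabsX z n : cabs (z ^+ n) = cabs z ^+ n.
Proof. by elim: n => [|n IH]; rewrite ?expr0 ?cabs1 // !exprS cabsM IH. Qed.

Lemma cabs_eq0 z : cabs z = 0 -> z = 0.
Proof. exact: ComplexField.Normc.eq0_normc. Qed.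

Lemma cabsR (x : R) : cabs (x%:C)%C = `|x|.
Proof. by rewrite /cabs /= expr0n addr0 sqrtr_sqr. Qed.

Lemma sqr_cabs z : cabs z ^+ 2 = Re z ^+ 2 + Im z ^+ 2.
Proof. by case: z => a b; rewrite /cabs /= sqr_sqrtr // addr_ge0 // sqr_ge0. Qed.

Lemma Re_le_cabs z : `|Re z| <= cabs z.
Proof.
rewrite -(@ler_pXn2r _ 2) ?nnegrE ?cabs_ge0 // sqr_cabs real_normK ?num_real //.
by rewrite lerDl sqr_ge0.
Qed.

Lemma ReD z w : Re (z + w) = Re z + Re w. Proof. by case: z; case: w. Qed.
Lemma ImD z w : Im (z + w) = Im z + Im w. Proof. by case: z; case: w. Qed.
Lemma ReN z : Re (- z) = - Re z. Proof. by case: z. Qed.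
Lemma ReM z w : Re (z * w) = Re z * Re w - Im z * Im w.
Proof. by case: z; case: w. Qed.
Lemma ImM z w : Im (z * w) = Re z * Im w + Im z * Re w.
Proof. by case: z; case: w => a b c d; rewrite /= [c * b + _]addrC // addrC. Qed.
Lemma ReMr z (x : R) : Re (z * (x%:C)%C) = Re z * x.
Proof. by rewrite ReM /= mulr0 subr0. Qed.
Lemma Re0 : Re (0 : R[i]) = 0. Proof. by []. Qed.

Lemma Re_sum (I : Type) (r : seq I) (P : pred I) (F : I -> R[i]) :
  Re (\sum_(i <- r | P i) F i) = \sum_(i <- r | P i) Re (F i).
Proof. exact: (big_morph _ ReD Re0). Qed.

Lemma cabs_sum (I : Type) (r : seq I) (P : pred I) (F : I -> R[i]) :
  cabs (\sum_(i <- r | P i) F i) <= \sum_(i <- r | P i) cabs (F i).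
Proof.
elim/big_ind2: _ => [|x x' y y' hx hy|//]; first by rewrite cabs0.
by rewrite (le_trans (cabsD _ _)) // lerD.
Qed.

Lemma bounded_mulmx m n (A : 'M[R[i]]_(m, n)) :
  exists2 C : R, 0 <= C & forall (u : 'rV_m) (b : R), 0 <= b ->
    (forall i, cabs (u 0 i) <= b) -> forall j, cabs ((u *m A) 0 j) <= C * b.
Proof.
exists (\sum_i \sum_j cabs (A i j)).
  by apply: sumr_ge0 => i _; apply: sumr_ge0 => j _; exact: cabs_ge0.
move=> u b b0 ub j; rewrite mxE (le_trans (cabs_sum _ _ _)) // mulr_suml.
apply: ler_sum => i _; rewrite cabsM mulrC ler_pM ?cabs_ge0 //.
by rewrite (bigD1 j) //= lerDl; apply: sumr_ge0 => k _; exact: cabs_ge0.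
Qed.

Lemma geometric_small (I : finType) (r a : I -> R) (e : R) : 0 < e ->
  (forall i, 0 <= r i < 1) -> (forall i, 0 <= a i) ->
  exists k0, forall k, (k0 <= k)%N -> forall i, a i * r i ^+ k <= e.
Proof.
move=> e0 r01 a0.
have H i : exists k0, forall k, (k0 <= k)%N -> a i * r i ^+ k <= e.
  have /andP[ri0 ri1] := r01 i.
  have /cvgr0Pnorm_le H : (fun k => a i * r i ^+ k) @ \oo --> (0 : R).
    rewrite -(mulr0 (a i)); apply: cvgMr.
    by apply: cvg_expr; rewrite ger0_norm.
  have [k0 _ k0P] := H _ e0.
  exists k0 => k kk; have := k0P k kk; apply: le_trans; exact: ler_norm.
have [f fP] := choice H.
exists (\max_i f i) => k kk i; apply: fP.
by apply: leq_trans kk; exact: leq_bigmax.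
Qed.
End Modulus.

(** * The sup norm of row vectors *)

Section RowNorm.
Context {R : realType} {d : nat}.
Implicit Types x y : 'rV[R]_d.

Lemma coord_le_norm x j : `|x 0 j| <= `|x|.
Proof.
rewrite [`|x|]/Num.norm /= mx_normrE.
exact: (le_bigmax _ (fun ij : 'I_1 * 'I_d => `|x ij.1 ij.2|) (0, j)).
Qed.

Lemma norm_le_coord x (b : R) : 0 <= b -> (forall j, `|x 0 j| <= b) -> `|x| <= b.
Proof.
move=> b0 xb; rewrite [`|x|]/Num.norm /= mx_normrE; apply: bigmax_le => //= -[i j] _ /=.
by rewrite ord1.
Qed.
End RowNorm.

(** * Gallai's theorem in an abelian group *)

Section Gallai.
Variable V : zmodType.

Definition mono_on (T : Type) (c : V -> T) (F : seq V) (p : V * nat) (g : T) :=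
  forall f, f \in F -> c (p.1 + f *+ p.2) = g.

(** The finite list of candidate copies is fixed before the colouring. This compact form permits
    colouring by finite windows in the induction and, later, a colouring that depends on the
    list. *)
Definition gallai_for (F : seq V) := forall T : finType,
  exists l : seq (V * nat), forall c : V -> T,
    exists2 p, p \in l & (0 < p.2)%N /\ exists g, mono_on c F p g.

(* Color focusing: either F together with h has a monochromatic homothetic
   copy, or there are n copies of F, monochromatic of n distinct colors, whose
   images of h all sit at the same point b. *)
Lemma focusing (F : seq V) (f0 h : V) (T : finType) (n : nat) :
  f0 \in F -> gallai_for F ->
  exists (l : seq (V * nat)) (lb : seq V), forall c : V -> T,
    (exists2 p, p \in l & (0 < p.2)%N /\ exists g, mono_on c (h :: F) p g) \/
    (exists2 b, b \in lb & exists s : seq ((V * nat) * T),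
      [/\ size s = n, uniq (map snd s) &
          forall q, q \in s -> [/\ q.1 \in l, (0 < q.1.2)%N,
            q.1.1 + h *+ q.1.2 = b & mono_on c F q.1 q.2]]).
Proof.
move=> f0F gF; elim: n => [|n [l [lb IH]]].
  by exists [::], [:: 0] => c; right; exists 0; rewrite ?mem_head //; exists [::].
(* [pos] contains every position that copies and foci of the previous stage can reach. Colouring a
   point by the colours seen on its translate of [pos] makes whole patterns repeat along a copy of
   [F]. *)
pose pos := lb ++ flatten [seq [seq p.1 + f *+ p.2 | f <- h :: F] | p <- l].
have posl p f : p \in l -> f \in h :: F -> p.1 + f *+ p.2 \in pos.
  move=> pl fF; rewrite mem_cat; apply/orP; right; apply/flatten_mapP.
  by exists p => //; apply/mapP; exists f.
have [l' gl'] := gF {ffun 'I_(size pos) -> T}.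
(* [l2]: previous copies moved to the base [a + f0 *+ k]; [l3]: previous copies with their step
   enlarged by [k]; [l4]: the new copy of [F] traced by the translates of a focus. *)
pose l2 := [seq (q.1 + f0 *+ q.2 + p.1, p.2) | q <- l', p <- l].
pose l3 := [seq (q.1 + p.1, (p.2 + q.2)%N) | q <- l', p <- l].
pose l4 := [seq (q.1 + b, q.2) | q <- l', b <- lb].
exists (l2 ++ l3 ++ l4), [seq q.1 + b + h *+ q.2 | q <- l', b <- lb] => c.
have [[a k] /= akl [k0 [g cg]]] :=
  gl' (fun x => [ffun i : 'I_(size pos) => c (x + nth 0 pos i)]).
have same f x : f \in F -> x \in pos -> c (a + f *+ k + x) = c (a + f0 *+ k + x).
  move=> fF xpos; have xi : (index x pos < size pos)%N by rewrite index_mem.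
  have /= := cg _ fF; rewrite -(cg _ f0F) /= => /ffunP/(_ (Ordinal xi)).
  by rewrite !ffunE /= nth_index.
have [[p pl [p0 [g' cg']]]|[b blb [s [ss us sP]]]] :=
  IH (fun x => c (a + f0 *+ k + x)).
  left; exists (a + f0 *+ k + p.1, p.2).
    by rewrite mem_cat; apply/orP; left; apply/allpairsP; exists ((a, k), p).
  by split=> //; exists g' => f fF /=; rewrite -addrA cg'.
have bpos : b \in pos by rewrite mem_cat blb.
(* If the focus has the colour of one of its copies, that copy extends to [h]. Otherwise the
   translates of the focus form a copy of a new colour, and all copies, with step enlarged by [k],
   refocus at [a + b + h *+ k]. *)
have [cb|cb] := boolP (c (a + f0 *+ k + b) \in map snd s).
  have /mapP[q qs qE] := cb; have [ql q0 qb qm] := sP q qs.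
  left; exists (a + f0 *+ k + q.1.1, q.1.2).
    by rewrite mem_cat; apply/orP; left; apply/allpairsP; exists ((a, k), q.1).
  split=> //; exists q.2 => f /=; rewrite inE => /orP[/eqP->|fF].
    by rewrite -addrA qb -qE.
  by rewrite -addrA; exact: qm.
right; exists (a + b + h *+ k).
  by apply/allpairsP; exists ((a, k), b).
exists (((a + b, k), c (a + f0 *+ k + b)) ::
  [seq ((a + q.1.1, (q.1.2 + k)%N), q.2) | q <- s]); split.
- by rewrite /= size_map ss.
- by rewrite /= -map_comp cb.
move=> q; rewrite inE => /orP[/eqP->|/mapP[r rs ->]] /=.
  split=> //.
    by rewrite !mem_cat; apply/orP; right; apply/orP; right;
       apply/allpairsP; exists ((a, k), b).
  by move=> f fF /=; rewrite addrAC same.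
have [rl r0 rb rm] := sP r rs; split.
- by rewrite !mem_cat; apply/orP; right; apply/orP; left;
     apply/allpairsP; exists ((a, k), r.1).
- by rewrite addn_gt0 r0.
- by rewrite mulrnDr -rb !addrA addrAC.
move=> f fF /=; rewrite mulrnDr -(rm _ fF) /=.
rewrite -(same _ _ fF) ?posl ?inE ?fF ?orbT //.
by congr c; rewrite !addrA [a + _ + _ + _]addrAC -!addrA; congr (_ + _); rewrite addrCA addrA addrC.
Qed.

Lemma gallai (F : seq V) : gallai_for F.
Proof.
elim: F => [|f F IH] T.
  exists [:: (0, 1%N)] => c; exists (0, 1%N); rewrite ?mem_head //.
  by split=> //; exists (c 0).
case: F IH => [_|f0 F IH].
  exists [:: (0, 1%N)] => c; exists (0, 1%N); rewrite ?mem_head //.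
  by split=> //; exists (c f) => x; rewrite inE => /eqP->; rewrite /= add0r.
(* With as many focused copies as there are colours, the colour of the focus must be among
   theirs. *)
have [l [lb H]] := @focusing (f0 :: F) f0 f T #|T| (mem_head _ _) IH.
exists l => c; have [//|[b _ [s [ss us sP]]]] := H c.
have /mapP[q qs qE] : c b \in map snd s.
  apply/negPn/negP => cs.
  have /card_uniqP uc : uniq (c b :: map snd s) by rewrite /= cs.
  by have := max_card (mem (c b :: map snd s)); rewrite uc /= size_map ss ltnn.
by have [ql q0 qb qm] := sP q qs; exists q.1 => //; split=> //; exists q.2 => x;
   rewrite inE => /orP[/eqP->|/qm//]; rewrite qb.
Qed.
End Gallai.

(** * Eigencoordinates of [Q] and the Euclidean seminorm of top modulus *)

Section EigenCoordinates.
Context {R : realType} {d : nat}.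
Variables (Q : 'M[R]_d) (P : 'M[R[i]]_d) (lam : 'rV[R[i]]_d).
Hypothesis Pu : P \in unitmx.
Hypothesis PQ : P *m mxC Q = diag_mx lam *m P.
Implicit Types x y : 'rV[R]_d.

(** Coordinate [j] pairs [x] with row [j] of [P], a left eigenvector of [Q]; so [linQ Q] multiplies
    it by [lam 0 j]. *)
Definition evec x : 'rV[R[i]]_d := map_mx (fun a : R => a%:C%C) x *m P^T.

Lemma evecD x y : evec (x + y) = evec x + evec y.
Proof. by rewrite /evec map_mxD mulmxDl. Qed.

Lemma evecZ (a : R) x : evec (a *: x) = (a%:C)%C *: evec x.
Proof. by rewrite /evec map_mxZ scalemxAl. Qed.

Lemma evec_linQ x j : evec (linQ Q x) 0 j = lam 0 j * evec x 0 j.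
Proof.
have -> : evec (linQ Q x) = evec x *m diag_mx lam.
  rewrite /evec /linQ map_mxM -!mulmxA; congr (_ *m _).
  have := congr1 trmx PQ; rewrite !trmx_mul tr_diag_mx => <-.
  by rewrite /mxC map_trmx.
by rewrite mul_mx_diag mxE mulrC.
Qed.

Lemma evec_iter k x j : evec (iter k (linQ Q) x) 0 j = lam 0 j ^+ k * evec x 0 j.
Proof. by elim: k => [|k IH]; rewrite ?mul1r // iterS evec_linQ IH mulrA exprS. Qed.

Lemma linQB x y : linQ Q (x - y) = linQ Q x - linQ Q y.
Proof. exact: mulmxBl. Qed.

Lemma iter_linQB k x y :
  iter k (linQ Q) (x - y) = iter k (linQ Q) x - iter k (linQ Q) y.
Proof. by elim: k => //= k ->; rewrite linQB. Qed.

Lemma evec_bound :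
  exists2 C : R, 0 <= C & forall x j, cabs (evec x 0 j) <= C * `|x|.
Proof.
have [C C0 H] := bounded_mulmx P^T; exists C => // x j; apply: H => // i.
by rewrite mxE cabsR coord_le_norm.
Qed.

Lemma norm_evec_bound :
  exists2 C : R, 0 <= C & forall x (b : R), 0 <= b ->
    (forall j, cabs (evec x 0 j) <= b) -> `|x| <= C * b.
Proof.
have [C C0 H] := bounded_mulmx (invmx P^T); exists C => // x b b0 xb.
apply: norm_le_coord => [|j]; first exact: mulr_ge0.
have := H _ _ b0 xb j; rewrite mulmxK ?unitmx_tr //.
by rewrite mxE cabsR.
Qed.

Hypothesis lam1 : forall j, 1 < cabs (lam 0 j).

Lemma unit_of_lam : Q \in unitmx.
Proof.
rewrite -(map_unitmx (real_complex R)) -[map_mx _ _]/(mxC Q).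
have -> : mxC Q = invmx P *m diag_mx lam *m P by rewrite -mulmxA -PQ mulKmx.
rewrite !unitmx_mul unitmx_inv Pu andbT /= unitmxE det_diag unitfE.
apply/prodf_neq0 => i _; apply/eqP => li; have := lam1 i.
by rewrite li cabs0 ltr10.
Qed.

Lemma linQ_surj k y : exists x, iter k (linQ Q) x = y.
Proof.
elim: k y => [|k IH] y; first by exists y.
have [x xy] := IH (y *m invmx Q^T); exists x.
by rewrite iterS xy /linQ mulmxKV // unitmx_tr unit_of_lam.
Qed.

Section TopModulus.
Variable t : R.
Hypothesis t1 : 1 < t.
Hypothesis lamt : forall j, cabs (lam 0 j) <= t.

Definition top j := cabs (lam 0 j) == t.

(** The real part of the Hermitian product of the top coordinates. Its seminorm is scaled by exactly
    [t] under [Q], and being quadratic it can be expanded at midpoints. *)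
Definition ip x y : R := \sum_(j | top j)
  (Re (evec x 0 j) * Re (evec y 0 j) + Im (evec x 0 j) * Im (evec y 0 j)).

Definition seminorm x := Num.sqrt (ip x x).

Lemma ipC x y : ip x y = ip y x.
Proof. by apply: eq_bigr => j _; ring. Qed.

Lemma ipDl x x' y : ip (x + x') y = ip x y + ip x' y.
Proof. by rewrite -big_split; apply: eq_bigr => j _; rewrite evecD mxE ReD ImD /=; ring. Qed.

Lemma ipZl (a : R) x y : ip (a *: x) y = a * ip x y.
Proof.
rewrite mulr_sumr; apply: eq_bigr => j _; rewrite evecZ mxE ReM ImM /=; ring.
Qed.

Lemma ipNl x y : ip (- x) y = - ip x y.
Proof. by rewrite -scaleN1r ipZl mulN1r. Qed.

Lemma ip_ge0 x : 0 <= ip x x.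
Proof. by apply: sumr_ge0 => j _; rewrite -!expr2 addr_ge0 // sqr_ge0. Qed.

Lemma ip_sqrD x y : ip (x + y) (x + y) = ip x x + 2 * ip x y + ip y y.
Proof. rewrite ipDl ![ip _ (x + y)]ipC !ipDl [ip y x]ipC; ring. Qed.

Lemma sqr_seminorm x : seminorm x ^+ 2 = ip x x.
Proof. by rewrite sqr_sqrtr ?ip_ge0. Qed.

Lemma seminorm_ge0 x : 0 <= seminorm x.
Proof. exact: sqrtr_ge0. Qed.

Lemma ipE x : ip x x = \sum_(j | top j) cabs (evec x 0 j) ^+ 2.
Proof. by apply: eq_bigr => j _; rewrite sqr_cabs !expr2. Qed.

Lemma seminorm_linQ x : seminorm (linQ Q x) = t * seminorm x.
Proof.
have t0 : 0 <= t := ltW (lt_trans ltr01 t1).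
rewrite /seminorm !ipE; under eq_bigr => j /eqP lj do rewrite evec_linQ cabsM lj exprMn.
by rewrite -mulr_sumr sqrtrM ?sqr_ge0 // sqrtr_sqr ger0_norm.
Qed.

Lemma seminorm_iter k x : seminorm (iter k (linQ Q) x) = t ^+ k * seminorm x.
Proof. by elim: k => [|k IH]; rewrite ?mul1r // iterS seminorm_linQ IH mulrA exprS. Qed.

Lemma evec_le_seminorm x j : top j -> cabs (evec x 0 j) <= seminorm x.
Proof.
move=> tj; rewrite -(@ler_pXn2r _ 2) ?nnegrE ?cabs_ge0 ?seminorm_ge0 //.
rewrite sqr_seminorm ipE (bigD1 j) //= lerDl.
by apply: sumr_ge0 => i _; exact: sqr_ge0.
Qed.

Lemma ip_bound : exists2 C : R, 0 <= C & forall x (b : R), `|x| <= b -> ip x x <= C * b ^+ 2.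
Proof.
have [C C0 H] := evec_bound; exists (\sum_(j | top j) C ^+ 2).
  by apply: sumr_ge0 => j _; exact: sqr_ge0.
move=> x b xb; rewrite ipE mulr_suml; apply: ler_sum => j _.
rewrite -exprMn ler_pXn2r ?nnegrE ?cabs_ge0 ?mulr_ge0 ?(le_trans _ xb) //.
by apply: le_trans (H _ _) _; exact: ler_wpM2l.
Qed.

(* Under rescaling by t^-k Q^k only the coordinates of top modulus survive, so
   a coarse Lipschitz bound becomes a bound by the seminorm. *)
Lemma top_seminorm_bound : exists2 C : R, 0 <= C & forall x (e : R), 0 < e ->
  exists k, `|iter k (linQ Q) x| + 1 <= t ^+ k * (C * seminorm x + e).
Proof.
have t0 : 0 < t := lt_trans ltr01 t1.
have [C C0 H] := norm_evec_bound; exists C => // x e e0.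
pose e1 := e / (2 * (C + 1)).
have e10 : 0 < e1 by rewrite divr_gt0 //; lra.
(* [Some j] stands for a coordinate, with ratio below 1 unless it is of top modulus; [None] stands
   for the additive constant 1, which decays like [t^-k]. *)
pose r (i : option 'I_d) := if i is Some j then (if top j then 0 else cabs (lam 0 j) / t) else t^-1.
pose a (i : option 'I_d) := if i is Some j then cabs (evec x 0 j) else 1 : R.
have [|||k0 k0P] := @geometric_small _ _ r a (Num.min e1 (e / 2)).
- by rewrite lt_min e10 divr_gt0.
- case=> [j|] /=; last by rewrite invr_ge0 ltW //= invf_lt1.
  case: ifP => [_|tj]; first by rewrite lexx ltr01.
  rewrite divr_ge0 ?cabs_ge0 ?ltW //= ltr_pdivrMr // mul1r lt_neqAle lamt andbT.
  by rewrite /top in tj; rewrite tj.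
- by case=> [j|] /=; rewrite ?cabs_ge0.
have {}k0P i : a i * r i ^+ k0.+1 <= e1 /\ a i * r i ^+ k0.+1 <= e / 2.
  by have := k0P k0.+1 (leqnSn _) i; rewrite le_min => /andP[].
exists k0.+1; set k := k0.+1 in k0P *.
have tk0 : 0 < t ^+ k by rewrite exprn_gt0.
have -> : t ^+ k * (C * seminorm x + e) =
    C * (t ^+ k * (seminorm x + e1)) + t ^+ k * (e / 2) + t ^+ k * (e / (2 * (C + 1))).
  rewrite /e1; field; lra.
rewrite -addrA lerD //.
  apply: H => [|j]; first by rewrite mulr_ge0 ?addr_ge0 ?seminorm_ge0 // ltW.
  rewrite evec_iter cabsM cabsX.
  have [tj|tj] := boolP (top j).
    rewrite (eqP tj) ler_pM2l //; apply: le_trans (evec_le_seminorm _ tj) _; lra.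
  have [/= kj _] := k0P (Some j); rewrite (negbTE tj) in kj.
  rewrite expr_div_n mulrA ler_pdivrMr // in kj.
  rewrite mulrC; apply: le_trans kj _; rewrite mulrC ler_pM2l //.
  by rewrite lerDr seminorm_ge0.
have [_ /=] := k0P None; rewrite mul1r exprVn => kj.
have : t ^+ k * (t ^+ k)^-1 <= t ^+ k * (e / 2) by rewrite ler_pM2l.
rewrite divff ?gt_eqF // => {}kj; apply: le_trans kj _.
by rewrite lerDl mulr_ge0 // ltW.
Qed.
End TopModulus.
End EigenCoordinates.

(** * Almost affine behaviour of an eigenfunctional on [X] *)

Section AlmostAffine.
Context {R : realType} {d : nat}.
Variables (Q : 'M[R]_d) (P : 'M[R[i]]_d) (lam : 'rV[R[i]]_d).
Hypothesis Pu : P \in unitmx.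
Hypothesis PQ : P *m mxC Q = diag_mx lam *m P.
Hypothesis lam1 : forall j, 1 < cabs (lam 0 j).
Variable X : set 'rV[R]_d.
Hypothesis XQ : forall x, X x -> X (linQ Q x).
Hypothesis X_rep : forall F : seq 'rV[R]_d, (forall a, a \in F -> X a) ->
  exists r : R, forall z, exists2 v, `|v - z| <= r & forall a, a \in F -> X (a + v).
Variables (theta : R[i]) (ell : 'rV[R]_d -> R[i]).
Hypothesis theta1 : 1 < cabs theta.
Hypothesis theta_top : forall j, cabs (lam 0 j) <= cabs theta.
Hypothesis ellQ : forall x y, X x -> X y ->
  ell (linQ Q x) - ell (linQ Q y) = theta * (ell x - ell y).
Hypothesis ell_diff : forall x x' y y', X x -> X x' -> X y -> X y' ->
  x - x' = y - y' -> ell x - ell x' = ell y - ell y'.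
Variable Clip : R.
Hypothesis Clip0 : 0 <= Clip.
Hypothesis ell_lip : forall x y, X x -> X y ->
  cabs (ell x - ell y) <= Clip * (`|x - y| + 1).

Local Notation t := (cabs theta).
Local Notation sn := (seminorm P lam t).
Local Notation ipt := (ip P lam t).
Local Notation f := (linQ Q).

Let t0 : 0 < t := lt_trans ltr01 theta1.

Lemma X_iter k x : X x -> X (iter k f x).
Proof. by move=> Xx; elim: k => //= k; exact: XQ. Qed.

Lemma ell_iter k x y : X x -> X y ->
  ell (iter k f x) - ell (iter k f y) = theta ^+ k * (ell x - ell y).
Proof.
move=> Xx Xy; elim: k => [|k IH]; first by rewrite mul1r.
by rewrite !iterS ellQ ?IH ?mulrA -?exprS //; exact: X_iter.
Qed.

(** Apply the coarse bound to [Q^k x] and [Q^k y] and divide by the [k]-th power of the modulus of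
    [theta]: for large [k] only the coordinates of top modulus remain. *)
Lemma ell_seminorm_lip : exists2 C : R, 0 <= C & forall x y, X x -> X y ->
  cabs (ell x - ell y) <= C * sn (x - y).
Proof.
have [C C0 H] := top_seminorm_bound Pu PQ theta1 theta_top.
exists (Clip * C); rewrite ?mulr_ge0 // => x y Xx Xy.
apply/ler_addgt0Pr => e e0.
have e10 : 0 < e / (Clip + 1) by rewrite divr_gt0 // ltr_wpDl.
have [k kP] := H (x - y) _ e10.
rewrite -(ler_pM2l (exprn_gt0 k t0)) -cabsX -cabsM -ell_iter // cabsX.
apply: le_trans (ell_lip _ _) _; [exact: X_iter..|].
rewrite -iter_linQB; apply: le_trans (ler_wpM2l Clip0 kP) _.
rewrite mulrCA ler_pM2l ?exprn_gt0 // mulrDr mulrA lerD2l.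
by rewrite mulrCA ler_piMr ?(ltW e0) // ler_pdivrMr ?mul1r ?ltr_wpDl // lerDl.
Qed.

(** [M] is the infimum of the admissible constants. Since [e < M] keeps [M - e] nonnegative, the
    absence of an almost extremal pair would make [M - e] admissible. *)
Lemma optimal_lip : exists2 M : R, 0 <= M &
  (forall x y, X x -> X y -> cabs (ell x - ell y) <= M * sn (x - y)) /\
  (forall e, 0 < e -> e < M -> exists x y, [/\ X x, X y &
     (M - e) * sn (x - y) < cabs (ell x - ell y)]).
Proof.
pose A : set R := [set C | 0 <= C /\ forall x y, X x -> X y ->
  cabs (ell x - ell y) <= C * sn (x - y)].
have [C C0 CP] := ell_seminorm_lip.
have A0 : A !=set0 by exists C.
have lbA : lbound A 0 by move=> z [].
have hA : has_inf A by split=> //; exists 0.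
have M0 : 0 <= inf A by exact: lb_le_inf.
exists (inf A) => //; split=> [x y Xx Xy|e e0 eM].
  apply/ler_addgt0Pr => e e0.
  have e10 : 0 < e / (sn (x - y) + 1) by rewrite divr_gt0 // ltr_wpDl // seminorm_ge0.
  have [D [D0 DP] DM] := inf_adherent e10 hA.
  apply: le_trans (DP _ _ Xx Xy) _.
  apply: (@le_trans _ _ ((inf A + e / (sn (x - y) + 1)) * sn (x - y))).
    by rewrite ler_wpM2r ?seminorm_ge0 // ltW.
  rewrite mulrDl lerD2l mulrAC -mulrA ler_piMr ?(ltW e0) //.
  by rewrite ler_pdivrMr ?mul1r ?lerDl ?ltr_wpDl ?seminorm_ge0 .
apply: contrapT => noxy.
have : A (inf A - e).
  split=> [|x y Xx Xy]; first by rewrite subr_ge0 ltW.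
  by rewrite leNgt; apply/negP => xy; apply: noxy; exists x, y.
by move=> /(ge_inf (ex_intro _ 0 lbA)); rewrite lerBrDr gerDl leNgt e0.
Qed.

Lemma exp_unbounded (b : R) : exists k, b <= t ^+ k.
Proof.
have [|||k0 /(_ k0 (leqnn _) tt)] :=
  @geometric_small _ unit (fun=> t^-1) (fun=> `|b| + 1) 1 => //.
  by move=> _ /=; rewrite invr_ge0 ltW //= invf_lt1.
rewrite exprVn ler_pdivrMr ?exprn_gt0 // mul1r => bk; exists k0.
by apply: le_trans bk; rewrite ler_wpDr // ler_norm.
Qed.

(** Used to bring an almost extremal segment, by [Q^-k], to a length between [S] and [t * S], so
    that it is long but of controlled length. *)
Lemma scale_between (S a : R) : 0 < S -> S <= a ->
  exists k, t ^+ k * S <= a < t ^+ k.+1 * S.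
Proof.
move=> S0 Sa.
have ex : exists n, a < t ^+ n.+1 * S.
  have [k kP] := exp_unbounded (a / S); exists k.
  apply: (@le_lt_trans _ _ (t ^+ k * S)); first by rewrite -ler_pdivrMr.
  by rewrite exprS -mulrA ltr_pMl // mulr_gt0 // exprn_gt0.
have [[|n] nP nmin] := ex_minnP ex; first by exists 0%N; rewrite mul1r Sa.
exists n.+1; rewrite nP andbT leNgt; apply/negP => /nmin.
by rewrite ltnn.
Qed.

Lemma ip_col w : exists e : 'cV[R]_d, forall x, ipt x w = (x *m e) 0 0.
Proof.
exists (\col_j ipt (delta_mx 0 j) w) => x.
rewrite {1}(row_sum_delta x) mxE.
have ip0 : ipt 0 w = 0 by rewrite -(scale0r (0 : 'rV[R]_d)) ipZl mul0r.
rewrite (big_morph (fun x => ipt x w) (fun x y => ipDl _ _ _ x y w) ip0).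
by apply: eq_bigr => j _; rewrite ipZl mxE.
Qed.

(* The distance from a point near the middle of a long segment to its ends is
   affine in the point up to an error of the order of the inverse length. *)
Lemma seminorm_midpoint delta w (S rho : R) : 0 < S -> ipt w w = S ^+ 2 ->
  ipt delta delta <= rho ->
  sn (delta + 2^-1 *: w) <= S / 2 + (ipt delta w + rho) / S.
Proof.
move=> S0 ww dd.
have sq : ipt (delta + 2^-1 *: w) (delta + 2^-1 *: w) =
    ipt delta delta + ipt delta w + S ^+ 2 / 4.
  rewrite ip_sqrD [ip _ _ _ _ (2^-1 *: w)]ipC ipZl [ip _ _ _ (2^-1 *: w) _]ipZl.
  rewrite [ip _ _ _ w (_ *: _)]ipC ipZl ww [ip _ _ _ w delta]ipC; by field.
pose T := (ipt delta w + rho) / S.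
have ST : S * T = ipt delta w + rho by rewrite /T mulrCA divff ?gt_eqF // mulr1.
have T0 : 0 <= S / 2 + T.
  have := ip_ge0 P lam t (delta + 2^-1 *: w); rewrite sq => h.
  rewrite -(pmulr_rge0 _ S0) mulrDr ST.
  have -> : S * (S / 2) = S ^+ 2 / 2 by ring.
  have := sqr_ge0 S; lra.
rewrite -[leRHS]ger0_norm // -sqrtr_sqr ler_wsqrtr // sq -/T.
have -> : (S / 2 + T) ^+ 2 = S ^+ 2 / 4 + S * T + T ^+ 2 by field.
rewrite ST; have := sqr_ge0 T; lra.
Qed.

Let error1 (M rho eta L : R) : 0 < eta ->
  4 * M * rho + eta <= L * eta -> 2 * M * rho <= eta / 2 * L.
Proof. by move=> h1 h2; lra. Qed.

Let error2 (e s S eta L : R) : e * (2 * s * S) <= eta -> e * L <= e * (s * S) ->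
  e * L <= eta / 2.
Proof. by move=> h1 h2; lra. Qed.

Let combine (A B D u1 v1 w1 x1 e1 f1 : R) :
  u1 + v1 - w1 - x1 = e1 -> e1 <= f1 -> A <= u1 -> B <= v1 -> w1 <= D ->
  A + B - D - x1 <= f1.
Proof. by move=> h1 h2 h3 h4 h5; lra. Qed.

(** The Lipschitz bounds towards the two ends of an almost extremal segment nearly add up to the
    total increment, so near the midpoint [ell] is squeezed onto an affine function. Repetitivity
    brings [F] there and [ell_diff] brings the estimate back. The phase [u] accounts for the
    direction of the complex increment. *)
Lemma almost_affine (F : seq 'rV[R]_d) (eta : R) : 0 < eta ->
  (forall a, a \in F -> X a) ->
  exists (u : R[i]) (e : 'cV[R]_d), [/\ cabs u = 1,
    Im theta = 0 -> (forall x y, X x -> X y -> Im (ell x - ell y) = 0) -> Im u = 0 &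
    forall a b, a \in F -> b \in F ->
      `|Re (u * (ell a - ell b)) - ((a - b) *m e) 0 0| <= eta].
Proof.
move=> eta0 FX.
have [M M0 [ellM Mopt]] := optimal_lip.
have [Meq|Mgt] : M = 0 \/ 0 < M by move: M0; rewrite le_eqVlt => /predU1P[->|]; [left|right].
  exists 1, 0; split=> [||a b aF bF]; rewrite ?cabs1 // mulmx0 mxE subr0 mul1r.
  have := ellM _ _ (FX _ aF) (FX _ bF); rewrite Meq mul0r => h.
  by rewrite (le_trans (Re_le_cabs _)) // (le_trans h) // ltW.
have [r rP] := X_rep FX.
have [Cip Cip0 ipb] := ip_bound P lam t.
(* Bounds the distance from the midpoint to each translated point of [F]. *)
pose rb := \sum_(a <- F) `|a| + r.
have Frb a z v : a \in F -> `|v - z| <= r -> `|a + v - z| <= rb.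
  move=> aF vz; rewrite -addrA (le_trans (ler_normD _ _)) // lerD //.
  by rewrite (big_rem a) //= lerDl; apply: sumr_ge0 => ? _.
pose rho := Cip * rb ^+ 2.
have rho0 : 0 <= rho by rewrite mulr_ge0 // sqr_ge0.
(* For length [L] at least [S], the midpoint error counted at both ends, [2 * M * rho / L], is at
   most [eta / 2]. *)
pose S := 4 * M * rho / eta + 1.
have S0 : 0 < S by rewrite ltr_wpDl // divr_ge0 ?(ltW eta0) // mulr_ge0 // mulr_ge0.
have tS0 : 0 < 2 * t * S by rewrite !mulr_gt0.
(* For length below [t * S] the defect from extremality is at most [eta / 2]; the bound [M / 2]
   keeps [eps] below [M]. *)
pose eps := Num.min (M / 2) (eta / (2 * t * S)).
have eps0 : 0 < eps by rewrite lt_min !divr_gt0.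
have epsM : eps < M by rewrite gt_min ltr_pdivrMr // ltr_pMr // ltr1n.
have epst : eps * (2 * t * S) <= eta by rewrite -ler_pdivlMr // ge_min lexx orbT.
have [y1 [x1 [Xy1 Xx1 xy1]]] := Mopt _ eps0 epsM.
have n1 : 0 < sn (y1 - x1).
  rewrite lt_neqAle seminorm_ge0 andbT; apply/eqP => n0.
  by have := lt_le_trans xy1 (ellM _ _ Xy1 Xx1); rewrite -n0 !mulr0 ltxx.
(* The extremal pair may be too short: powers of [Q] stretch it to length at least [S] and preserve
   the ratio. *)
have [j jP] := exp_unbounded (S / sn (y1 - x1)).
pose y := iter j f y1; pose x := iter j f x1.
have Xy : X y by exact: X_iter.
have Xx : X x by exact: X_iter.
have yx : (M - eps) * sn (y - x) < cabs (ell y - ell x).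
  rewrite ell_iter // -iter_linQB (seminorm_iter PQ) // cabsM cabsX mulrCA.
  by rewrite ltr_pM2l ?exprn_gt0.
have SL : S <= sn (y - x).
  by rewrite -iter_linQB (seminorm_iter PQ) // -ler_pdivrMr.
have : 0 < cabs (ell y - ell x).
  by apply: le_lt_trans yx; rewrite mulr_ge0 ?seminorm_ge0 // subr_ge0 ltW.
set D := ell y - ell x in yx * => D0.
have [k /andP[k1 k2]] := scale_between S0 SL.
have tk0 : 0 < t ^+ k by rewrite exprn_gt0.
(* The pulled back endpoints need not lie in [X], so [ell] is only evaluated after [Q^k] is
   applied. *)
have [x' x'E] := linQ_surj Pu PQ lam1 k x.
have [y' y'E] := linQ_surj Pu PQ lam1 k y.
pose w := y' - x'; pose L := sn w.
have snyx : sn (y - x) = t ^+ k * L by rewrite -x'E -y'E -iter_linQB (seminorm_iter PQ).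
have L1 : S <= L by rewrite -(ler_pM2l tk0) -snyx.
have L2 : L < t * S by rewrite -(ltr_pM2l tk0) -snyx mulrA -exprSr.
have L0 : 0 < L := lt_le_trans S0 L1.
have ww : ipt w w = L ^+ 2 by rewrite sqr_seminorm.
pose mid := 2^-1 *: (x' + y').
have [v vmid vX] := rP mid.
have [e eE] := ip_col w.
(* The phase that turns the increment [D] into a positive real; [u'] below also absorbs the argument
   of [theta ^+ k]. *)
pose u := conjc D / ((cabs D)%:C)%C.
have CD0 : ((cabs D)%:C)%C != 0 :> R[i] by rewrite (fmorph_eq0 (real_complex R)) gt_eqF.
have uD : u * D = ((cabs D)%:C)%C.
  have -> : u * D = D * conjc D / ((cabs D)%:C)%C by rewrite /u; ring.
  have -> : D * conjc D = ((cabs D)%:C)%C ^+ 2 by rewrite -sqr_normc cabsE.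
  by rewrite expr2 mulfK.
have u1 : cabs u = 1.
  by apply: (mulIf (lt0r_neq0 D0)); rewrite mul1r -cabsM uD cabsR ger0_norm ?cabs_ge0.
pose u' := u * theta ^+ k / ((t ^+ k)%:C)%C.
have Ctk : ((t ^+ k)%:C)%C != 0 :> R[i] by rewrite (fmorph_eq0 (real_complex R)) gt_eqF.
exists u', ((M / L) *: e); split.
- by rewrite /u' 2!cabsM u1 mul1r cabsV cabsR ger0_norm ?(ltW tk0) // cabsX divff // gt_eqF.
- move=> It IX.
  have Itk : Im (theta ^+ k) = 0.
    by elim: (k) => [//|i IH]; rewrite exprS ImM It IH mulr0 mul0r addr0.
  have ID : Im D = 0 by exact: IX.
  have Iu : Im (conjc D) = 0 by case: (D) ID => a b /= ->; rewrite oppr0.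
  by rewrite /u' /u -!fmorphV !ImM Itk Iu /= !(mulr0, mul0r, addr0).
pose del a := a + v - mid.
have delP a : a \in F -> ipt (del a) (del a) <= rho by move=> aF; exact/ipb/Frb.
pose g a := ipt (del a) w.
pose z a := iter k f (a + v).
have Xz a : a \in F -> X (z a) by move=> aF; exact/X_iter/vX.
have upx a : a \in F -> Re (u * (ell (z a) - ell x)) <=
    t ^+ k * (M * (L / 2 + (g a + rho) / L)).
  move=> aF; apply: le_trans (ler_norm _) _; apply: le_trans (Re_le_cabs _) _.
  rewrite cabsM u1 mul1r; apply: le_trans (ellM _ _ (Xz _ aF) Xx) _.
  rewrite -x'E -iter_linQB (seminorm_iter PQ) // mulrCA !ler_pM2l //.
  have -> : a + v - x' = del a + 2^-1 *: w.
    by apply/matrixP => i i'; rewrite !mxE; field.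
  exact: seminorm_midpoint (delP _ aF).
have upy a : a \in F -> Re (u * (ell y - ell (z a))) <=
    t ^+ k * (M * (L / 2 + (- g a + rho) / L)).
  move=> aF; apply: le_trans (ler_norm _) _; apply: le_trans (Re_le_cabs _) _.
  rewrite cabsM u1 mul1r; apply: le_trans (ellM _ _ Xy (Xz _ aF)) _.
  rewrite -y'E -iter_linQB (seminorm_iter PQ) // mulrCA !ler_pM2l //.
  have -> : y' - (a + v) = - del a + 2^-1 *: w.
    by apply/matrixP => i i'; rewrite !mxE; field.
  rewrite -[- g a]ipNl; apply: seminorm_midpoint => //.
  by rewrite ipNl ipC ipNl opprK delP.
have half a b : a \in F -> b \in F ->
    Re (u' * (ell a - ell b)) - ((a - b) *m ((M / L) *: e)) 0 0 <= eta.
  move=> aF bF.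
  have E1 : u' * (ell a - ell b) * ((t ^+ k)%:C)%C = u * (ell (z a) - ell (z b)).
    have -> : ell a - ell b = ell (a + v) - ell (b + v).
      apply: ell_diff; [exact: FX|exact: FX|exact: vX|exact: vX|].
      by rewrite opprD addrACA subrr addr0.
    rewrite (ell_iter k (vX _ aF) (vX _ bF)) /u' mulrAC divfK //; ring.
  (* The difference between two points is the path from [x] to [z a], plus the path from [z b] to
     [y], minus the whole segment. The first two are bounded above by the Lipschitz property, the
     third below by near extremality. *)
  have E2 : t ^+ k * Re (u' * (ell a - ell b)) =
     Re (u * (ell (z a) - ell x)) + Re (u * (ell y - ell (z b))) - cabs D.
    have -> : cabs D = Re (u * D) by rewrite uD.
    rewrite -ReN -!ReD /D.
    have -> : u * (ell (z a) - ell x) + u * (ell y - ell (z b)) + - (u * (ell y - ell x)) =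
      u' * (ell a - ell b) * ((t ^+ k)%:C)%C by rewrite E1; ring.
    by rewrite ReMr mulrC.
  rewrite -scalemxAr mxE -eE -(ler_pM2l tk0) mulrBr E2.
  have -> : ipt (a - b) w = g a - g b.
    rewrite /g -ipNl -ipDl; congr (ipt _ w).
    by apply/matrixP => i i'; rewrite !mxE; ring.
  have := upx a aF; have := upy b bF; move: yx; rewrite snyx => yx1 h1 h2.
  have e1 : 2 * M * rho / L <= eta / 2.
    rewrite ler_pdivrMr //.
    have Se : S * eta = 4 * M * rho + eta by rewrite /S mulrDl mul1r divfK // gt_eqF.
    have h := ler_wpM2r (ltW eta0) L1; rewrite Se in h; exact: error1 eta0 h.
  have e2 : eps * L <= eta / 2.
    exact: error2 epst (ler_wpM2l (ltW eps0) (ltW L2)).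
  have E3 : t ^+ k * (M * (L / 2 + (g a + rho) / L)) +
      t ^+ k * (M * (L / 2 + (- g b + rho) / L)) - (M - eps) * (t ^+ k * L) -
      t ^+ k * (M / L * (g a - g b)) = t ^+ k * (2 * M * rho / L + eps * L).
    by field; rewrite gt_eqF.
  have E4 : t ^+ k * (2 * M * rho / L + eps * L) <= t ^+ k * eta.
    by rewrite ler_pM2l // (splitr eta) lerD.
  exact: combine E3 E4 h2 h1 (ltW yx1).
move=> a b aF bF; rewrite ler_norml half // andbT -lerN2 opprK.
have := half b a bF aF; rewrite -[b - a]opprB mulNmx mxE -[ell b - ell a]opprB mulrN ReN.
by rewrite opprB addrC opprK.
Qed.
End AlmostAffine.

(** * Rational bases of finitely generated spans *)

Section RationalBasis.
Context {R : realType}.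
Local Notation mr := (map_mx (ratr : rat -> R)).

(** Factor [H] through as few rows as possible. A rational relation [q] would give the rational
    projection [A], which fixes [E] and has smaller rank, hence a shorter factorisation. *)
Lemma rational_basis d p (H : 'M[R]_(p, d)) :
  exists s (E : 'M[R]_(s, d)) (C : 'M[rat]_(p, s)) (D : 'M[rat]_(s, p)),
    [/\ H = mr C *m E, E = mr D *m H &
        forall q : 'rV[rat]_s, mr q *m E = 0 -> q = 0].
Proof.
pose Pn s := `[< exists (E : 'M[R]_(s, d)) (C : 'M[rat]_(p, s)) (D : 'M[rat]_(s, p)),
  H = mr C *m E /\ E = mr D *m H >].
have exP : exists s, Pn s.
  by exists p; apply/asboolP; exists H, 1%:M, 1%:M; rewrite !map_mx1 !mul1mx.
have [s /asboolP[E [C [D [HE ED]]]] smin] := ex_minnP exP.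
exists s, E, C, D; split=> // q qE; apply/eqP/negPn/negP => /rV0Pn[j qj].
pose q' : 'cV[rat]_s := (q 0 j)^-1 *: delta_mx j 0.
have qq' : q *m q' = 1%:M.
  apply/matrixP => a b; rewrite !ord1 !mxE (bigD1 j) //= !mxE !eqxx mulr1 mulfV //.
  by rewrite big1 ?addr0 // => k /negbTE kj; rewrite !mxE kj mulr0 mulr0.
pose A := 1%:M - q' *m q.
have qA : q *m A = 0 by rewrite mulmxBr mulmx1 mulmxA qq' mul1mx subrr.
have AE : mr A *m E = E by rewrite map_mxB map_mx1 map_mxM mulmxBl mul1mx -mulmxA qE mulmx0 subr0.
have rA : (\rank A < s)%N.
  rewrite ltn_neqAle rank_leq_row andbT; apply/negP => Af.
  have /eqP : q *m A = 0 := qA.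
  rewrite mulmx_free_eq0 // => /eqP q0.
  by move: qj; rewrite q0 mxE eqxx.
have := smin (\rank A); rewrite leqNgt rA => /(_ _)/negP; apply=> //.
apply/asboolP; exists (mr (row_base A) *m E), (C *m col_base A), (row_base A *m D); split.
  by rewrite map_mxM !mulmxA -[mr C *m _ *m _]mulmxA -map_mxM mulmx_base -mulmxA AE.
by rewrite [in RHS]map_mxM -[RHS]mulmxA -ED.
Qed.

Lemma common_denominator p s (C : 'M[rat]_(p, s)) :
  exists2 D0 : nat, (0 < D0)%N & forall i j, D0%:R * C i j \is a Num.int.
Proof.
exists (\prod_i \prod_j `|denq (C i j)|)%N.
  by apply: prodn_gt0 => i; apply: prodn_gt0 => j; rewrite absz_gt0 denq_eq0.
move=> i j; rewrite (bigD1 i) //= (bigD1 j) //= !natrM.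
have -> : `|denq (C i j)|%:R = (denq (C i j))%:~R :> rat.
  by rewrite -[in RHS](gez0_abs (denq_ge0 _)) -pmulrn.
by rewrite mulrC !mulrA -numqE -mulrA -natrM rpredM ?natr_int ?intr_int.
Qed.
End RationalBasis.

(** * Relatively dense sets with locally finite differences *)

Section DelonePoints.
Context {R : realType} {d : nat}.
Local Notation V := 'rV[R]_d.
Variable X : set V.
Variable r : R.
Hypothesis r0 : 0 <= r.
Hypothesis X_rd : forall z : V, exists2 x, X x & `|x - z| <= r.

(** From [z], go back by [r + 1] towards [x] and then to a point of [X] within [r]: the step has
    length at most [2 * r + 1] and the distance to [x] drops by at least 1. *)
Lemma chain_ind (Pr : V -> V -> nat -> Prop) :
  (forall x y, X x -> X y -> `|y - x| <= 2 * r + 1 -> Pr x y 1%N) ->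
  (forall x y z n, X x -> X y -> X z -> Pr x y n -> `|z - y| <= 2 * r + 1 ->
     Pr x z n.+1) ->
  forall x y, X x -> X y -> exists2 n, n%:R <= `|y - x| + 2 & Pr x y n.
Proof.
move=> P1 PS x y Xx Xy.
have H n z : X z -> `|z - x| <= n%:R -> exists2 k, (k <= n.+1)%N & Pr x z k.
  elim: n z => [|n IH] z Xz zn.
    by exists 1%N => //; apply: P1 => //; rewrite (le_trans zn) // addr_ge0 // mulr_ge0.
  have [zs|zl] := leP `|z - x| (2 * r + 1); first by exists 1%N => //; exact: P1.
  pose L := `|z - x|.
  have L0 : 0 < L by apply: le_lt_trans zl; rewrite addr_ge0 // mulr_ge0.
  have [x' Xx' x'w] := X_rd (x + ((L - (r + 1)) / L) *: (z - x)).
  have [|k kn Pk] := IH x' Xx'.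
    have -> : x' - x = (x' - (x + ((L - (r + 1)) / L) *: (z - x))) +
        ((L - (r + 1)) / L) *: (z - x) by rewrite opprD addrA subrK.
    apply: le_trans (ler_normD _ _) _; rewrite normrZ -/L ger0_norm; last first.
      have zl' : 2 * r + 1 < L := zl; apply: divr_ge0 (ltW L0).
      by rewrite subr_ge0; have := r0; lra.
    rewrite divfK ?gt_eqF //; rewrite -/L -natr1 in zn; move: x'w; lra.
  exists k.+1 => //; apply: (PS _ x') => //.
  have -> : z - x' = - (x' - (x + ((L - (r + 1)) / L) *: (z - x))) + ((r + 1) / L) *: (z - x).
    have -> : (L - (r + 1)) / L = 1 - (r + 1) / L by rewrite mulrBl divff ?gt_eqF.
    by apply/matrixP => i j; rewrite !mxE; ring.
  apply: le_trans (ler_normD _ _) _; rewrite normrN normrZ -/L ger0_norm; last first.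
    by rewrite divr_ge0 ?(ltW L0) // addr_ge0.
  by rewrite divfK ?gt_eqF //; move: x'w; lra.
have [k kn Pk] := H (Num.truncn `|y - x|).+1 y Xy (ltW (truncnS_gt _)).
exists k => //; have := truncn_itv (normr_ge0 (y - x)) => /andP[h _].
apply: (@le_trans _ _ ((Num.truncn `|y - x|).+2)%:R); first by rewrite ler_nat.
by rewrite -addn2 natrD lerD2r.
Qed.

(** Shows that [X - X] spans: [X] has points far in the direction of [w], whose pairing with [w]
    could not vanish. *)
Lemma orthogonal_eq0 (w : 'cV[R]_d) :
  (forall x y, X x -> X y -> ((x - y) *m w) 0 0 = 0) -> w = 0.
Proof.
move=> ort; have [x0 Xx0 _] := X_rd 0.
pose n2 := \sum_j w j 0 ^+ 2; pose K := r * \sum_j `|w j 0|.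
have n20 : 0 <= n2 by apply: sumr_ge0 => j _; exact: sqr_ge0.
have [n2z|n2p] : n2 = 0 \/ 0 < n2.
  by move: n20; rewrite le_eqVlt => /predU1P[->|]; [left|right].
  apply/matrixP => i j; rewrite ord1 [RHS]mxE; apply/eqP; rewrite -sqrf_eq0.
  by apply/eqP/(psumr_eq0P _ n2z) => // k _; exact: sqr_ge0.
(* The displacement pairs with [w] to [K + 1], while a correction of norm at most [r] contributes at
   most [K]. *)
have [x Xx xz] := X_rd (x0 + ((K + 1) / n2) *: w^T).
have h : ((x - (x0 + ((K + 1) / n2) *: w^T)) *m w) 0 0 = - (K + 1).
  rewrite opprD addrA mulmxBl mxE (ort _ _ Xx Xx0) -scalemxAl !mxE sub0r.
  have -> : \sum_j w^T 0 j * w j 0 = n2 by apply: eq_bigr => j _; rewrite mxE expr2.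
  by rewrite divfK // gt_eqF.
have : `|((x - (x0 + ((K + 1) / n2) *: w^T)) *m w) 0 0| <= K.
  rewrite mxE (le_trans (ler_norm_sum _ _ _)) // [leRHS]mulr_sumr; apply: ler_sum => j _.
  by rewrite normrM ler_wpM2r //; apply: le_trans (coord_le_norm _ _) xz.
have K0 : 0 <= K by rewrite mulr_ge0 // sumr_ge0.
rewrite h normrN ger0_norm ?addr_ge0 // => hK; exfalso; lra.
Qed.

Hypothesis X_fin : forall rho : R,
  finite_set [set v : V | `|v| <= rho /\ exists x y, [/\ X x, X y & v = x - y]].

(** Short differences take finitely many values, so [ell] has bounded increments along the steps of
    a chain; the number of steps is at most the distance plus 2. *)
Lemma coarse_lip (ell : V -> R[i]) :
  (forall x x' y y', X x -> X x' -> X y -> X y' -> x - x' = y - y' ->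
     ell x - ell x' = ell y - ell y') ->
  exists2 C : R, 0 <= C & forall x y, X x -> X y ->
     cabs (ell x - ell y) <= C * (`|x - y| + 1).
Proof.
move=> elld; have [G GE] := (finite_seqP _).1 (X_fin (2 * r + 1)).
have /choice[c cP] : forall g : V, exists c : R, 0 <= c /\ forall x y, X x -> X y -> x - y = g ->
    cabs (ell x - ell y) <= c.
  move=> g; have [[x [y [Xx Xy xy]]]|nog] := pselect (exists x y, [/\ X x, X y & x - y = g]).
    exists (cabs (ell x - ell y)); rewrite cabs_ge0; split=> // x' y' Xx' Xy' x'y'.
    by rewrite (elld x' y' x y) // x'y' xy.
  by exists 0; split=> // x y Xx Xy xy; case: nog; exists x, y.
pose C := \sum_(g <- G) c g.
have C0 : 0 <= C by apply: sumr_ge0 => g _; case: (cP g).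
have small x y : X x -> X y -> `|y - x| <= 2 * r + 1 -> cabs (ell y - ell x) <= C.
  move=> Xx Xy yx.
  have : [set` G] (y - x) by rewrite -GE; split=> //; exists y, x.
  move=> /= gG; rewrite /C (big_rem _ gG) /=.
  apply: (@le_trans _ _ (c (y - x))); first by have [_] := cP (y - x); exact.
  by rewrite lerDl; apply: sumr_ge0 => g _; case: (cP g).
exists (2 * C) => [|y x Xy Xx]; first exact: mulr_ge0.
have [||n nP nC] := @chain_ind (fun x y n => cabs (ell y - ell x) <= n%:R * C) _ _ x y Xx Xy.
- by move=> a b Xa Xb ab; rewrite mul1r small.
- move=> a b e n Xa Xb Xe ab be.
  have -> : ell e - ell a = (ell b - ell a) + (ell e - ell b) by ring.
  by rewrite (le_trans (cabsD _ _)) // -natr1 mulrDl mul1r lerD // small.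
apply: le_trans nC _; rewrite [2 * C]mulrC -mulrA [leLHS]mulrC ler_wpM2l //.
by apply: le_trans nP _; have := normr_ge0 (y - x); lra.
Qed.

Variable Q : 'M[R]_d.
Hypothesis XQ : forall x, X x -> X (linQ Q x).
Local Notation mr := (map_mx (ratr : rat -> R)).

(* Rows of E: a basis over the rationals of the span of X - X, on which Q acts
   by B, in which differences of points of X have denominators dividing D0. *)
Lemma difference_lattice :
  exists (s p : nat) (E : 'M[R]_(s, d)) (B : 'M[rat]_s) (D0 : nat)
      (a b : 'I_p -> V) (C : 'M[rat]_(p, s)) (D : 'M[rat]_(s, p)),
    [/\ forall q : 'rV[rat]_s, mr q *m E = 0 -> q = 0,
        E *m Q^T = mr B *m E,
        (0 < D0)%N /\ forall x y, X x -> X y -> exists q : 'rV[rat]_s,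
           x - y = mr q *m E /\ forall j, D0%:R * q 0 j \is a Num.int,
        (forall i, [/\ X (a i), X (b i) & a i - b i = row i (mr C *m E)]) /\ D *m C = 1%:M &
        row_full E].
Proof.
have [G GE] := (finite_seqP _).1 (X_fin (2 * r + 1)).
have Gp (i : 'I_(size G)) : exists ab : V * V, [/\ X ab.1, X ab.2 & G`_i = ab.1 - ab.2].
  have : [set` G] G`_i by rewrite /= mem_nth.
  by rewrite -GE => -[_ [x [y xy]]]; exists (x, y).
have [ab abP] := choice Gp.
pose H : 'M[R]_(size G, d) := \matrix_i G`_i.
have [s [E [C [D [HE ED ind]]]]] := rational_basis H.
have [D0 D00 D0P] := common_denominator C.
have small x y : X x -> X y -> `|y - x| <= 2 * r + 1 -> exists i, y - x = mr (row i C) *m E.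
  move=> Xx Xy yx.
  have /= gG : [set` G] (y - x) by rewrite -GE; split=> //; exists y, x.
  have iG : (index (y - x)%R G < size G)%N by rewrite index_mem.
  exists (Ordinal iG); rewrite map_row -row_mul -HE rowK nth_index //.
have intq x y : X x -> X y -> exists q : 'rV[rat]_s,
           x - y = mr q *m E /\ forall j, D0%:R * q 0 j \is a Num.int.
  move=> Xx Xy; have [||n _ //] := @chain_ind (fun y x _ => exists q : 'rV[rat]_s,
           x - y = mr q *m E /\ forall j, D0%:R * q 0 j \is a Num.int) _ _ y x Xy Xx.
    move=> u v Xu Xv /(small _ _ Xu Xv)[i ->]; exists (row i C); split=> // j.
    by rewrite mxE D0P.
  move=> u v w n Xu Xv Xw [q [vu qi]] /(small _ _ Xv Xw)[i wv].
  exists (q + row i C); split=> [|j].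
    by rewrite map_mxD mulmxDl -vu -wv [RHS]addrC addrA subrK.
  by rewrite !mxE mulrDr rpredD // D0P.
have /choice[q qP] : forall i : 'I_(size G), exists q : 'rV[rat]_s,
    linQ Q (ab i).1 - linQ Q (ab i).2 = mr q *m E.
  move=> i; have [Xa Xb _] := abP i.
  by have [q [qE _]] := intq _ _ (XQ Xa) (XQ Xb); exists q.
exists s, (size G), E, (D *m \matrix_i q i), D0, (fun i => (ab i).1), (fun i => (ab i).2), C, D.
split=> //.
- have HQ : H *m Q^T = mr (\matrix_i q i) *m E.
    apply/row_matrixP => i; rewrite !row_mul -map_row !rowK -qP.
    by have [_ _ ->] := abP i; rewrite -linQB.
  by rewrite map_mxM -mulmxA -HQ mulmxA -ED.
- split=> [i|].
    by have [Xa Xb abE] := abP i; rewrite -HE rowK -abE.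
  apply/row_matrixP => i; apply/eqP; rewrite -subr_eq0; apply/eqP/ind.
  rewrite -linearB /= map_row -row_mul map_mxB map_mxM mulmxBl -mulmxA -HE -ED.
  by rewrite map_mx1 mul1mx subrr row0.
(* A column annihilated by [E] is orthogonal to [X - X], hence zero. *)
rewrite /row_full -mxrank_tr -[_ == d]/(row_free _) -kermx_eq0.
apply/eqP/row_matrixP => i; rewrite row0; apply/trmx_inj; rewrite trmx0.
apply: orthogonal_eq0 => x y Xx Xy; have [u [-> _]] := intq x y Xx Xy.
rewrite -mulmxA.
have -> : E *m (row i (kermx E^T))^T = 0.
  by apply/trmx_inj; rewrite trmx_mul trmxK trmx0 -row_mul mulmx_ker row0.
by rewrite mulmx0 mxE.
Qed.
End DelonePoints.

(** * Diagonalised matrices and multiplicities of eigenvalues *)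

Section Diagonalization.
Variable F : fieldType.

Lemma diagonalizable_rows n (A : 'M[F]_n) : diagonalizable A ->
  exists (P : 'M[F]_n) (lam : 'rV[F]_n), P \in unitmx /\ P *m A = diag_mx lam *m P.
Proof.
move=> [P Pu /diagonalizable_forPex[lam /(simmxP Pu) PA]]; by exists P, lam.
Qed.

Lemma diagonal_rows_tr n (A P : 'M[F]_n) lam : P \in unitmx ->
  P *m A = diag_mx lam *m P -> (invmx P)^T *m A^T = diag_mx lam *m (invmx P)^T.
Proof.
move=> Pu PA; rewrite -trmx_mul -[diag_mx lam]tr_diag_mx -trmx_mul; congr trmx.
by rewrite -[A in LHS](mulKmx Pu) PA -!mulmxA mulmxV // mulmx1.
Qed.

Lemma rank_diag n (u : 'rV[F]_n) : \rank (diag_mx u) = #|[pred i | u 0 i != 0]|.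
Proof.
set S := [pred i | _]; pose f (k : 'I_#|S|) := enum_val k.
pose M : 'M[F]_(#|S|, n) := rowsub f 1%:M.
have finj : injective f := @enum_val_inj _ S.
have MM : M *m M^T = 1%:M.
  apply/matrixP => i j; rewrite !mxE (bigD1 (f i)) //= big1 ?addr0 => [|k /negbTE kf].
    by rewrite !mxE eqxx mul1r (inj_eq finj) eq_sym.
  by rewrite !mxE eq_sym kf mul0r.
have -> : diag_mx u = M^T *m (diag_mx (\row_k u 0 (f k)) *m M).
  apply/matrixP => i j; rewrite mul_diag_mx !mxE.
  have [iS|iS] := boolP (i \in S).
    pose k : 'I_#|S| := enum_rank_in iS i.
    have fk : f k = i by rewrite /f /k enum_rankK_in.
    rewrite (bigD1 k) //= big1 ?addr0 => [|l lk].
      by rewrite !mxE fk eqxx mul1r mulr_natr.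
    rewrite !mxE; have /negbTE -> : f l != i by rewrite -fk (inj_eq finj).
    by rewrite mul0r.
  move: (iS); rewrite inE negbK => /eqP->; rewrite mul0rn big1 // => l _.
  rewrite !mxE; have /negbTE -> : f l != i.
    by apply: contraNneq iS => <-; exact: enum_valP.
  by rewrite mul0r.
have fM : row_free M.
  by apply/row_freeP; exists M^T.
have fMT : row_full M^T.
  by apply/row_fullP; exists M.
rewrite (eqmxMfull _ fMT) mxrankMfree // mxrank_unit //.
rewrite unitmxE det_diag unitfE; apply/prodf_neq0 => k _; rewrite mxE.
by have := enum_valP k; rewrite inE.
Qed.

Section Multiplicity.
Variables (n : nat) (A P : 'M[F]_n) (lam : 'rV[F]_n).
Hypothesis Pu : P \in unitmx.
Hypothesis PA : P *m A = diag_mx lam *m P.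

Lemma row_eigenvector j : row j P *m A = lam 0 j *: row j P.
Proof.
by rewrite -row_mul PA mul_diag_mx; apply/matrixP => i k; rewrite !mxE.
Qed.

Lemma diagonal_eigenvalue j : eigenvalue A (lam 0 j).
Proof.
apply/eigenvalueP; exists (row j P); first exact: row_eigenvector.
apply/eqP => P0; have := congr1 (fun v => (v *m invmx P) 0 j) P0.
by rewrite -row_mul mulmxV // mul0mx !mxE eqxx => /eqP; rewrite oner_eq0.
Qed.

Lemma char_poly_diagonal : char_poly A = \prod_i ('X - (lam 0 i)%:P).
Proof.
have -> : char_poly A = char_poly (diag_mx lam).
  have PX : map_mx polyC P *m char_poly_mx A =
            char_poly_mx (diag_mx lam) *m map_mx polyC P.
    rewrite /char_poly_mx mulmxBr mulmxBl -!map_mxM PA; congr (_ - _).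
    by rewrite scalar_mxC.
  have dP : \det (map_mx polyC P) != 0.
    by rewrite det_map_mx polyC_eq0 -unitfE -unitmxE.
  by apply: (mulfI dP); rewrite -det_mulmx PX det_mulmx mulrC.
rewrite char_poly_trig; last exact: diag_mx_is_trig.
by apply: eq_bigr => i _; rewrite mxE eqxx.
Qed.

(** Both sides count the indices [i] with [lam 0 i = theta]. *)
Lemma rank_eigenspace theta : \rank (eigenspace A theta) = mup theta (char_poly A).
Proof.
have -> : mup theta (char_poly A) = #|[pred i | lam 0 i == theta]|.
  rewrite char_poly_diagonal -(big_map (fun i => lam 0 i) predT (fun x => 'X - x%:P)).
  by rewrite mu_prod_XsubC count_map -sum1_count -sum1_card.
rewrite /eigenspace mxrank_ker.
have -> : \rank (A - theta%:M) = \rank (diag_mx (\row_i (lam 0 i - theta))).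
  have -> : diag_mx (\row_i (lam 0 i - theta)) = P *m (A - theta%:M) *m invmx P.
    rewrite mulmxBr mulmxBl PA mulmxK // scalar_mxC mulmxK //.
    by apply/matrixP => i j; rewrite !mxE; case: eqP => _; rewrite ?mulr1n ?mulr0n ?subrr.
  by rewrite mxrankMfree ?row_free_unit ?unitmx_inv // (eqmxMfull _ _) // row_full_unit.
rewrite rank_diag -[X in (X - _)%N](card_ord n) -(cardC [pred i | lam 0 i == theta]).
rewrite (_ : #|[pred i | _ != 0]| = #|[predC [pred i | lam 0 i == theta]]|) ?addnK //.
by apply: eq_card => i; rewrite !inE mxE subr_eq0.
Qed.
End Multiplicity.
End Diagonalization.

(** * Minimal polynomials and multiplicities of conjugate roots *)

Section Conjugates.
Context {R : realType}.
Local Notation C := R[i].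
Local Notation pC := (map_poly (ratr : rat -> C)).

(** Take [p] of least degree. The gcd [g] of [p] and its derivative is of smaller degree, so [z] is
    a root of the separable quotient [p %/ g], which [p] then divides. *)
Lemma min_poly_exists (z : C) :
  (exists q : {poly rat}, q != 0 /\ root (pC q) z) ->
  exists p : {poly rat}, [/\ root (pC p) z, separable_poly p &
    forall q, root (pC q) z -> p %| q].
Proof.
move=> exq.
pose Pn n := `[< exists q : {poly rat}, [/\ q != 0, root (pC q) z & size q = n] >].
have exP : exists n, Pn n.
  by have [q [q0 qz]] := exq; exists (size q); apply/asboolP; exists q.
have [n /asboolP[p [p0 pz sp]] nmin] := ex_minnP exP.
have min q : q != 0 -> root (pC q) z -> (size p <= size q)%N.
  by move=> q0 qz; rewrite sp; apply: nmin; apply/asboolP; exists q.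
have dvd q : root (pC q) z -> p %| q.
  move=> qz; rewrite /dvdp; apply/negPn/negP => r0.
  have : root (pC (q %% p)) z.
    have := qz; rewrite {1}(divp_eq q p) rmorphD rmorphM /=.
    by rewrite /root !hornerE (eqP (pz : _ == 0)) mulr0 add0r.
  by move=> /(min _ r0); rewrite leqNgt ltn_modp p0.
exists p; split=> //.
have h0 := make_separable p0; set g := gcdp p (deriv p) in h0.
have gp : g %| p by exact: dvdp_gcdl.
have pE : p = p %/ g * g by rewrite divpK.
have p1 : (1 < size p)%N.
  rewrite ltnNge; apply/negP => /size1_polyC pc; move: pz p0.
  by rewrite pc map_polyC /= rootC fmorph_eq0 polyC_eq0 => ->.
have p'0 : (deriv p) != 0.
  apply: contraNneq p0 => p'0; have := coef_deriv p (size p).-2.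
  rewrite p'0 coef0 prednK -?subn1 ?subn_gt0 // subn1 => /esym/eqP.
  by rewrite mulrn_eq0 -lead_coefE lead_coef_eq0 -subn1 subn_eq0 leqNgt p1.
have hz : root (pC (p %/ g)) z.
  move: (pz); rewrite {1}pE rmorphM rootM => /orP[//|gz].
  have g0 : g != 0 by apply: contraNneq p0 => g0; rewrite pE g0 mulr0.
  have := min _ g0 gz; rewrite leqNgt => /negP[].
  apply: leq_ltn_trans (dvdp_leq p'0 (dvdp_gcdr _ _)) _.
  exact: lt_size_deriv.
rewrite -(@eqp_separable _ (p %/ g)) //.
rewrite /eqp (dvd _ hz) andbT {2}pE dvdp_mulr //.
Qed.

Lemma separable_mup (p : {poly rat}) (z : C) :
  separable_poly p -> root (pC p) z -> mup z (pC p) = 1%N.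
Proof.
move=> sp /factor_theorem[q pq].
have spC : separable_poly (pC p) by rewrite separable_map.
have p0 := separable_poly_neq0 spC.
move: spC; rewrite pq separable_root => /andP[_ qz].
rewrite mupMr // -['X - _]expr1 mup_XsubCX eqxx //.
Qed.

(** Divide [chi] repeatedly by the minimal polynomial, of which [z] and [w] are both simple
    roots. *)
Lemma conj_mup (z w : C) (chi : {poly rat}) : chi != 0 ->
  alg_conj z w -> alg_conj w z -> mup z (pC chi) = mup w (pC chi).
Proof.
move=> + [exq zw] [_ wz]; have [p [pz sp pdvd]] := min_poly_exists exq.
suff H : (forall (n : nat) (q : {poly rat}), (size q < n)%N -> q != 0 ->
    mup z (pC q) = mup w (pC q)).
  exact (H (size chi).+1 chi (ltnSn _)).
elim=> [q h|n IH {}chi]; first discriminate h.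
rewrite ltnS => chin chi0.
have [chz|chz] := boolP (root (pC chi) z); last first.
  have chw : ~~ root (pC chi) w by apply: contra chz; exact: wz.
  rewrite (mupNroot chz) (mupNroot chw); reflexivity.
have /dvdpP[q qE] := pdvd _ chz.
have q0 : q != 0 by apply: contraNneq chi0 => q0; rewrite qE q0 mul0r.
have p0 : p != 0 by apply: contraNneq chi0 => p0; rewrite qE p0 mulr0.
have pC0 : pC p != 0 by rewrite map_poly_eq0.
have qC0 : pC q != 0 by rewrite map_poly_eq0.
have chiE : pC chi = pC q * pC p by rewrite qE rmorphM.
rewrite chiE (mupM z qC0 pC0) (mupM w qC0 pC0).
rewrite (separable_mup sp pz) (separable_mup sp (zw _ pz)) (IH q _ q0); first reflexivity.
apply: leq_trans chin; rewrite qE size_mul // -subn1.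
have p1 : (1 < size p)%N.
  rewrite ltnNge; apply/negP => /size1_polyC pc; move: pz p0.
  by rewrite pc map_polyC /= rootC fmorph_eq0 polyC_eq0 => ->.
by rewrite ltn_subRL addnC ltn_add2l.
Qed.
End Conjugates.

(** * Comparison of the eigenvectors of [B] and of [Q] *)

Section InternalSpace.
Context {R : realType}.
Local Notation C := R[i].
Local Notation pC := (map_poly (ratr : rat -> C)).
Local Notation mr := (map_mx (ratr : rat -> R)).
Local Notation mc := (map_mx (real_complex R)).
Local Notation mq := (map_mx (ratr : rat -> C)).

Lemma map_mx_real_rat m n (A : 'M[rat]_(m, n)) : mc (mr A) = mq A.
Proof. by apply/matrixP => i j; rewrite !mxE fmorph_rat. Qed.

Lemma map_mx_real_inj m n : injective (mc : 'M[R]_(m, n) -> 'M[C]_(m, n)).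
Proof.
move=> U V /matrixP h; apply/matrixP => i j.
by have := h i j; rewrite !mxE; exact: complexI.
Qed.

Variables (d s : nat) (Q : 'M[R]_d) (E : 'M[R]_(s.+1, d)) (B : 'M[rat]_s.+1).
Variables (P : 'M[C]_d) (lam : 'rV[C]_d) (j0 : 'I_d).
Hypothesis Pu : P \in unitmx.
Hypothesis PQ : P *m mxC Q = diag_mx lam *m P.
Hypothesis E_ind : forall q : 'rV[rat]_s.+1, mr q *m E = 0 -> q = 0.
Hypothesis EQ : E *m Q^T = mr B *m E.
Hypothesis E_full : row_full E.
Hypothesis Q_conj : forall z w, spec Q z -> spec Q w -> alg_conj z w /\
  mup z (char_poly (mxC Q)) = mup w (char_poly (mxC Q)).
Hypothesis Q_pisot : pisot_family (spec Q).

Hypothesis rigid : forall c : 'rV[C]_s.+1, c *m (mq B)^T = lam 0 j0 *: c ->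
  exists w : 'rV[C]_d, c = w *m (mc E)^T.

Local Notation A2 := ((mq B)^T).
Local Notation Z := ((mc E)^T).

Let spec_lam j : spec Q (lam 0 j).
Proof. exact: diagonal_eigenvalue Pu PQ j. Qed.

(** So right multiplication by [Z] carries left eigenvectors of [Q] to left eigenvectors of [A2],
    with the same eigenvalue. *)
Lemma intertwine : mxC Q *m Z = Z *m A2.
Proof.
rewrite -trmx_mul -[mxC Q]trmxK -trmx_mul; congr trmx.
by rewrite -map_mx_real_rat -map_mxM -EQ map_mxM /mxC map_trmx.
Qed.

Lemma Z_free : row_free Z.
Proof. by rewrite /row_free mxrank_tr mxrank_map; exact: E_full. Qed.

Lemma horner_intertwine (q : {poly C}) :
  horner_mx (mq B) q *m (mc E *m P^T) = (mc E *m P^T) *m diag_mx (\row_j q.[lam 0 j]).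
Proof.
set Y := mc E *m P^T.
have BY : mq B *m Y = Y *m diag_mx lam.
  have := congr1 trmx intertwine; rewrite !trmx_mul !trmxK => h.
  rewrite mulmxA -h -!mulmxA; congr (_ *m _).
  by rewrite -[diag_mx lam]tr_diag_mx -!trmx_mul PQ.
elim/poly_ind: q => [|q c IH].
  rewrite rmorph0 mul0mx; apply/esym/matrixP => i j.
  by rewrite mul_mx_diag !mxE horner0 mulr0.
rewrite rmorphD rmorphM /= horner_mx_X horner_mx_C mulmxDl -mulmxA BY mulmxA IH.
rewrite mul_scalar_mx; apply/matrixP => i j.
rewrite [LHS]mxE -[X in X + _]/((_ *m _) i j) !mul_mx_diag !mxE !hornerE; ring.
Qed.

(** [horner_intertwine] and invertibility of [P] give that [p(B)] kills [E]; as the rows of [E] are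
    independent over the rationals, the rational matrix [p(B)] vanishes. *)
Lemma horner_B_eq0 (p : {poly rat}) : (forall j, root (pC p) (lam 0 j)) -> horner_mx B p = 0.
Proof.
move=> pl; set H := horner_mx B p.
have h : mq H *m (mc E *m P^T) = 0.
  rewrite map_horner_mx horner_intertwine; apply/matrixP => i j.
  by rewrite mul_mx_diag !mxE (eqP (pl j)) mulr0.
have {}h : mr H *m E = 0.
  apply: map_mx_real_inj; rewrite map_mxM map_mx_real_rat map_mx0.
  rewrite -[LHS](mulmxK (_ : P^T \in unitmx)) ?unitmx_tr //.
  by rewrite -[mq H *m mc E *m P^T]mulmxA h mul0mx.
apply/row_matrixP => i; rewrite row0; apply: E_ind.
by rewrite map_row -row_mul h row0.
Qed.

(** The minimal polynomial of the eigenvalues of [Q] annihilates [B], so [B] is diagonalizable with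
    conjugate eigenvalues. One of modulus at least 1 lies in [spec Q] by the Pisot property, and
    comparing dimensions shows that its eigenspace comes from [Q]. *)
Lemma internal_eigenvectors : exists (P2 : 'M[C]_s.+1) (lam2 : 'rV[C]_s.+1),
  [/\ P2 \in unitmx, P2 *m A2 = diag_mx lam2 *m P2 &
   forall i, cabs (lam2 0 i) < 1 \/ exists w : 'rV[C]_d, row i P2 = w *m Z].
Proof.
have [l lE] : {l | l = lam 0 j0} by exists (lam 0 j0).
have spec_l : spec Q l by rewrite lE; exact: spec_lam.
have [[exq _] _] := Q_conj spec_l spec_l.
have [p [pl sp pdvd]] := min_poly_exists exq.
have pj j : root (pC p) (lam 0 j).
  by have [[_ h] _] := Q_conj spec_l (spec_lam j); exact: h.
have pB : horner_mx (mq B) (pC p) = 0 by rewrite -map_horner_mx horner_B_eq0 // map_mx0.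
have dB : diagonalizable (mq B).
  apply/diagonalizableP; have [rs rsE] := closed_field_poly_normal (pC p).
  have p0 : lead_coef (pC p) != 0.
    by rewrite lead_coef_eq0 map_poly_eq0 separable_poly_neq0.
  exists rs.
    have : separable_poly (pC p) by rewrite separable_map.
    by rewrite rsE (eqp_separable (eqp_scale _ p0)) separable_prod_XsubC.
  have := mxminpoly_min pB; rewrite rsE dvdpZr //.
have [P1 [lam2 [P1u P1B]]] := diagonalizable_rows dB.
have rootl i : root (pC p) (lam2 0 i).
  have := diagonal_eigenvalue P1u P1B i; rewrite eigenvalue_root_min => h.
  by have /dvdpP[q' ->] := mxminpoly_min pB; rewrite rootM h orbT.
have P2u : (invmx P1)^T \in unitmx by rewrite unitmx_tr unitmx_inv.
have P2A : (invmx P1)^T *m A2 = diag_mx lam2 *m (invmx P1)^T by exact: diagonal_rows_tr.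
move: (invmx P1)^T P2u P2A => P2 P2u P2A.
exists P2, lam2; split=> // i; have [li|li] := ltP (cabs (lam2 0 i)) 1; [by left|right].
have Pi := row_eigenvector P2A i.
move: (lam2 0 i) li (rootl i) Pi => th li pth Pi.
have conj_th : alg_conj l th.
  by split=> // q ql; have /dvdpP[q' ->] := pdvd _ ql; rewrite rmorphM rootM pth orbT.
have spec_th : spec Q th.
  have [_ h] := Q_pisot spec_l; apply: h conj_th _.
  by rewrite cabsE -(rmorph1 (real_complex R)) lecR.
have [conj_l mupQ] := Q_conj spec_th spec_l.
have chi0 : char_poly B^T != 0 by exact/monic_neq0/char_poly_monic.
have chiE : char_poly A2 = pC (char_poly B^T) by rewrite map_char_poly map_trmx.
(* In [B] conjugates share their multiplicity because the characteristic polynomial is rational; in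
   [Q] they do so by hypothesis. *)
have r2 : \rank (eigenspace A2 th) = \rank (eigenspace A2 l).
  rewrite (rank_eigenspace P2u P2A th) (rank_eigenspace P2u P2A l) chiE.
  exact (conj_mup chi0 conj_l conj_th).
have r1 : \rank (eigenspace (mxC Q) th) = \rank (eigenspace (mxC Q) l).
  have e1 := rank_eigenspace Pu PQ th; have e2 := rank_eigenspace Pu PQ l.
  exact (etrans e1 (etrans mupQ (esym e2))).
(* Rigidity writes each eigenvector for [l] as [w *m Z], and injectivity of [Z] makes [w] an
   eigenvector of [Q]. *)
have rl : (\rank (eigenspace A2 l) <= \rank (eigenspace (mxC Q) l))%N.
  rewrite -(mxrankMfree (eigenspace (mxC Q) l) Z_free); apply: mxrankS.
  apply/row_subP => k.
  have /eigenspaceP ck : (row k (eigenspace A2 l) <= eigenspace A2 l)%MS by exact: row_sub.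
  have [|w wE] := rigid (c := row k (eigenspace A2 l)); first by rewrite -lE.
  rewrite wE; apply: submxMr; apply/eigenspaceP.
  by apply: (row_free_inj Z_free); rewrite -mulmxA intertwine mulmxA -wE ck wE -scalemxAl.
have subth : (eigenspace (mxC Q) th *m Z <= eigenspace A2 th)%MS.
  apply/eigenspaceP; rewrite -mulmxA -intertwine mulmxA scalemxAl; congr (_ *m _).
  exact/eigenspaceP.
have sup : (eigenspace A2 th <= eigenspace (mxC Q) th *m Z)%MS.
  have := mxrank_leqif_sup subth => -[_ <-].
  rewrite eqn_leq; apply/andP; split; first exact (mxrankS subth).
  have aux (n1 n2 n3 n4 n5 : nat) : n1 = n2 -> (n2 <= n3)%N -> n4 = n3 -> n5 = n4 -> (n1 <= n5)%N.
    by move=> -> + -> ->.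
  exact (aux _ _ _ _ _ r2 rl r1 (mxrankMfree _ Z_free)).
have : (row i P2 <= eigenspace A2 th)%MS by exact/eigenspaceP.
by move=> /submx_trans/(_ sup)/submx_trans/(_ (submxMl _ _))/submxP.
Qed.
End InternalSpace.

(** * Rigidity and approximation of [X] by lattices *)

Section MeyerProperty.
Context {R : realType} {d : nat}.
Local Notation V := 'rV[R]_d.
Local Notation C := R[i].
Local Notation mr := (map_mx (ratr : rat -> R)).
Local Notation mc := (map_mx (real_complex R)).
Local Notation mq := (map_mx (ratr : rat -> C)).

Variables (Q : 'M[R]_d) (X : set V) (r : R).
Hypothesis r0 : 0 <= r.
Hypothesis X_rd : forall z : V, exists2 x, X x & `|x - z| <= r.
Hypothesis X_fin : forall rho : R,
  finite_set [set v : V | `|v| <= rho /\ exists x y, [/\ X x, X y & v = x - y]].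
Hypothesis XQ : forall x, X x -> X (linQ Q x).
Hypothesis X_rep : forall F : seq V, (forall a, a \in F -> X a) ->
  exists r : R, forall z, exists2 v, `|v - z| <= r & forall a, a \in F -> X (a + v).

Variables (P : 'M[C]_d) (lam : 'rV[C]_d).
Hypothesis Pu : P \in unitmx.
Hypothesis PQ : P *m mxC Q = diag_mx lam *m P.
Hypothesis lam1 : forall j, 1 < cabs (lam 0 j).

Lemma linQ_bound : exists2 A : R, 0 <= A & forall v : V, `|linQ Q v| <= A * `|v|.
Proof.
have [A A0 H] := bounded_mulmx (mc Q^T); exists A => // v.
apply: norm_le_coord => [|j]; first exact: mulr_ge0.
have := H (mc v) `|v| (normr_ge0 _) _ j; rewrite -map_mxM mxE cabsR; apply=> i.
by rewrite mxE cabsR coord_le_norm.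
Qed.

Lemma expansion_factor : exists2 mu : R, 1 < mu & forall j, mu <= cabs (lam 0 j).
Proof.
exists (\big[Num.min/2]_j cabs (lam 0 j)).
  by apply/bigmin_gtP; split=> [|j _]; rewrite ?ltr1n // lam1.
by move=> j; exact: bigmin_le_cond.
Qed.

(* Each point of X is, up to a bounded error, the image under Q of a point of
   X that is closer to the origin; a contracted functional sums these errors
   like a geometric series. *)
Lemma internal_bounded (theta : C) (l : V -> C) : cabs theta < 1 ->
  (forall x x' y y', X x -> X x' -> X y -> X y' -> x - x' = y - y' -> l x - l x' = l y - l y') ->
  (forall x y, X x -> X y -> l (linQ Q x) - l (linQ Q y) = theta * (l x - l y)) ->
  forall x0, X x0 -> exists2 A : R, 0 <= A & forall x, X x -> cabs (l x - l x0) <= A.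
Proof.
move=> th1 ld lQ x0 Xx0.
have [K K0 lip] := coarse_lip r0 X_rd X_fin ld.
have [mu mu1 mul] := expansion_factor.
have [A A0 QA] := linQ_bound.
have [C1 C10 H1] := evec_bound P.
have [C2 C20 H2] := norm_evec_bound Pu.
have mu0 : 0 < mu := lt_trans ltr01 mu1.
(* Chosen so that pulling back by [Q] and moving to a point of [X] lowers a bound [rho + n.+1] on
   the eigencoordinates to [rho + n]. *)
pose rho := (1 + mu * (C1 * r)) / (mu - 1).
have mu10 : 0 < mu - 1 by rewrite subr_gt0.
have rho0 : 0 <= rho by rewrite divr_ge0 ?(ltW mu10) // addr_ge0 // !mulr_ge0 // ltW.
pose D1 := K * (A * r + 1) + cabs (l (linQ Q x0) - l x0).
have D10 : 0 <= D1 by rewrite addr_ge0 ?cabs_ge0 // mulr_ge0 // addr_ge0 // mulr_ge0.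
pose D0 := K * (C2 * rho + `|x0| + 1).
have D00 : 0 <= D0 by rewrite mulr_ge0 // !addr_ge0 // mulr_ge0.
have th10 : 0 < 1 - cabs theta by rewrite subr_gt0.
(* [D] covers the base case and is stable under the recursion [D1 + cabs theta * D]. *)
pose D := Num.max D0 (D1 / (1 - cabs theta)).
have DD0 : D0 <= D by rewrite le_max lexx.
have DD1 : D1 + cabs theta * D <= D.
  have : D1 / (1 - cabs theta) <= D by rewrite le_max lexx orbT.
  by rewrite ler_pdivrMr // mulrBr mulr1 lerBrDr mulrC.
have D_ge0 : 0 <= D := le_trans D00 DD0.
have H n x : X x -> (forall j, cabs (evec P x 0 j) <= rho + n%:R) -> cabs (l x - l x0) <= D.
  elim: n x => [|n IH] x Xx xn.
    apply: le_trans DD0; apply: le_trans (lip _ _ Xx Xx0) _.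
    rewrite ler_wpM2l // lerD2r (le_trans (ler_normB _ _)) // lerD2r.
    by apply: H2 => // j; rewrite (le_trans (xn j)) // addr0.
  have [y yx] := linQ_surj Pu PQ lam1 1 x; rewrite /= in yx.
  have [x1 Xx1 x1y] := X_rd y.
  have lx1 : cabs (l x1 - l x0) <= D.
    apply: IH => // j.
    have -> : x1 = y + (x1 - y) by rewrite addrC subrK.
    rewrite evecD mxE (le_trans (cabsD _ _)) //.
    have e1 : cabs (evec P y 0 j) <= (rho + n.+1%:R) / mu.
      rewrite ler_pdivlMr //; apply: le_trans (xn j); rewrite -yx (evec_linQ PQ) cabsM mulrC.
      by rewrite ler_wpM2r ?cabs_ge0.
    have e2 : cabs (evec P (x1 - y) 0 j) <= C1 * r by apply: le_trans (H1 _ _) _; rewrite ler_wpM2l.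
    apply: le_trans (lerD e1 e2) _; rewrite -(ler_pM2r mu0) mulrDl divfK ?gt_eqF //.
    have rhoE : rho * (mu - 1) = 1 + mu * (C1 * r) by rewrite divfK // gt_eqF.
    have nn : (0 : R) <= n%:R by [].
    rewrite -natr1; nra.
  have -> : l x - l x0 = (l x - l (linQ Q x1)) + (l (linQ Q x0) - l x0) +
      (l (linQ Q x1) - l (linQ Q x0)) by ring.
  apply: le_trans DD1; rewrite (le_trans (cabsD _ _)) // lerD //; last first.
    by rewrite lQ // cabsM ler_wpM2l ?cabs_ge0.
  rewrite (le_trans (cabsD _ _)) // lerD //; apply: le_trans (lip _ _ Xx (XQ Xx1)) _.
  rewrite ler_wpM2l // lerD2r -yx -linQB (le_trans (QA _)) // ler_wpM2l //.
  by rewrite distrC.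
exists D => // x Xx; apply: (H (Num.bound (C1 * `|x|))) => // j.
apply: le_trans (H1 _ _) _; rewrite ler_wpDl // ltW //.
by apply: archi_boundP; rewrite mulr_ge0.
Qed.

Section Coordinates.
Variables (s p : nat) (E : 'M[R]_(s, d)) (B : 'M[rat]_s) (a b : 'I_p -> V)
  (Cm : 'M[rat]_(p, s)) (Dm : 'M[rat]_(s, p)) (kap : V -> 'rV[rat]_s).
Hypothesis E_ind : forall q : 'rV[rat]_s, mr q *m E = 0 -> q = 0.
Hypothesis EQ : E *m Q^T = mr B *m E.
Hypothesis kapE : forall x y, X x -> X y -> x - y = mr (kap x - kap y) *m E.
Hypothesis Xab : forall i, [/\ X (a i), X (b i) & a i - b i = row i (mr Cm *m E)].
Hypothesis DC : Dm *m Cm = 1%:M.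

(** The linear functional [c] applied to the rational coordinates [kap x]; since [kap] describes
    differences only, just the increments of [ell] are meaningful. *)
Definition ell (c : 'rV[C]_s) x : C := (mq (kap x) *m c^T) 0 0.

Lemma E_inj (q q' : 'rV[rat]_s) : mr q *m E = mr q' *m E -> q = q'.
Proof.
move=> qq'; apply/eqP; rewrite -subr_eq0; apply/eqP/E_ind.
by rewrite map_mxB mulmxBl qq' subrr.
Qed.

Lemma ellB c x y : ell c x - ell c y = (mq (kap x - kap y) *m c^T) 0 0.
Proof. by rewrite map_mxB mulmxBl [RHS]mxE [X in _ = _ + X]mxE. Qed.

Lemma ell_diff c x x' y y' : X x -> X x' -> X y -> X y' ->
  x - x' = y - y' -> ell c x - ell c x' = ell c y - ell c y'.
Proof.
move=> Xx Xx' Xy Xy' xy; rewrite !ellB; suff -> : kap x - kap x' = kap y - kap y' by [].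
by apply: E_inj; rewrite -!kapE.
Qed.

Lemma ellQ c theta x y : c *m (mq B)^T = theta *: c -> X x -> X y ->
  ell c (linQ Q x) - ell c (linQ Q y) = theta * (ell c x - ell c y).
Proof.
move=> cB Xx Xy; rewrite !ellB.
have -> : kap (linQ Q x) - kap (linQ Q y) = (kap x - kap y) *m B.
  apply: E_inj; rewrite -kapE; [|exact: XQ..].
  by rewrite -linQB (kapE Xx Xy) /linQ map_mxM -!mulmxA EQ.
have cB' : mq B *m c^T = theta *: c^T.
  by apply/trmx_inj; rewrite trmx_mul trmxK cB [RHS]linearZ /= trmxK.
by rewrite map_mxM -mulmxA cB' -scalemxAr mxE.
Qed.

Lemma ell_ab c i : ell c (a i) - ell c (b i) = (mq Cm *m c^T) i 0.
Proof.
have [Xa Xb abE] := Xab i; rewrite ellB.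
have -> : kap (a i) - kap (b i) = row i Cm.
  by apply: E_inj; rewrite -kapE // abE map_row row_mul.
by rewrite map_row -row_mul mxE.
Qed.

Section Rigidity.
Variable theta : C.
Hypothesis theta1 : 1 < cabs theta.
Hypothesis theta_top : forall j, cabs (lam 0 j) <= cabs theta.

(** A row of [K] is a real linear relation between the rows of [E]. Written through [Dm] in the
    differences [a i - b i], it cancels the linear part of [almost_affine] and leaves only the
    error. *)
Lemma almost_linear n (K : 'M[R]_(n, s)) (c : 'rV[C]_s) (eta : R) :
  K *m E = 0 -> c *m (mq B)^T = theta *: c -> 0 < eta ->
  exists u : C, [/\ cabs u = 1,
    Im theta = 0 -> (exists cr : 'rV[R]_s, c = mc cr) -> Im u = 0 &
    forall j, `|Re (u * (mc K *m c^T) j 0)| <= eta].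
Proof.
move=> KE cB eta0.
have [Clip Clip0 ellc] := coarse_lip r0 X_rd X_fin (@ell_diff c).
pose F := codom a ++ codom b.
have FX x : x \in F -> X x.
  by rewrite mem_cat => /orP[] /codomP[i ->]; have [] := Xab i.
(* [Cg] exceeds the total weight of these relations, so the error [eta / Cg] per difference
   suffices. *)
pose G := K *m mr Dm; pose Cg := \sum_j \sum_i `|G j i| + 1.
have Cg0 : 0 < Cg.
  by rewrite ltr_wpDl //; apply: sumr_ge0 => j _; apply: sumr_ge0.
have eta10 : 0 < eta / Cg by rewrite divr_gt0.
have [u [e [u1 ur ue]]] := almost_affine Pu PQ lam1 XQ X_rep theta1 theta_top
  (fun x y => @ellQ c theta x y cB) (@ell_diff c) Clip0 ellc eta10 FX.
exists u; split=> // [t0 [cr crE]|j].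
  apply: ur => // x y _ _; rewrite ellB crE.
  by rewrite -map_mx_real_rat map_trmx -map_mxM mxE.
pose y i := (mq Cm *m c^T) i 0; pose ye i := ((a i - b i) *m e) 0 0.
have KcE : (mc K *m c^T) j 0 = \sum_i (G j i)%:C%C * y i.
  have -> : mc K *m c^T = mc G *m (mq Cm *m c^T).
    rewrite /G map_mxM map_mx_real_rat -!mulmxA [mq Dm *m _]mulmxA -map_mxM DC.
    by rewrite map_mx1 mul1mx.
  by rewrite mxE; apply: eq_bigr => i _; rewrite mxE.
have KeE : \sum_i G j i * ye i = 0.
  have : G *m (mr Cm *m E *m e) = 0.
    by rewrite /G !mulmxA -[K *m _ *m _]mulmxA -map_mxM DC map_mx1 mulmx1 KE mul0mx.
  move=> /matrixP/(_ j 0); rewrite [X in _ = X]mxE mxE => h; rewrite -[RHS]h; apply: eq_bigr => i _.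
  have [_ _ abE] := Xab i; rewrite /ye abE -row_mul.
  by congr (_ * _); rewrite [LHS]mxE.
have -> : Re (u * (mc K *m c^T) j 0) = \sum_i G j i * (Re (u * y i) - ye i).
  under [RHS]eq_bigr do rewrite mulrBr.
  rewrite sumrB KeE subr0 KcE mulr_sumr Re_sum; apply: eq_bigr => i _.
  by rewrite mulrCA [(_%:C)%C * _]mulrC ReMr mulrC.
apply: le_trans (ler_norm_sum _ _ _) _.
apply: (@le_trans _ _ (\sum_i `|G j i| * (eta / Cg))).
  apply: ler_sum => i _; rewrite normrM ler_wpM2l // /y -ell_ab.
  by apply: ue; rewrite mem_cat codom_f ?orbT.
rewrite -mulr_suml mulrCA ler_piMr ?(ltW eta0) // ler_pdivrMr // mul1r /Cg.
rewrite (bigD1 j) //= -addrA lerDl addr_ge0 //.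
by apply: sumr_ge0 => k _; apply: sumr_ge0.
Qed.

Lemma kernel_rowspace (c : 'rV[C]_s) : mc (cokermx E^T)^T *m c^T = 0 ->
  (c <= (mc E)^T)%MS.
Proof.
move=> h; have -> : (mc E)^T = mc E^T by apply/matrixP => i j; rewrite !mxE.
rewrite submxE -map_cokermx; apply/eqP/trmx_inj; rewrite trmx_mul trmx0 -h.
by congr (_ *m _); apply/matrixP => i j; rewrite !mxE.
Qed.

Lemma squeeze0 (z : R) (A : R) : (forall eta : R, 0 < eta -> `|z| <= A * eta) -> z = 0.
Proof.
move=> h; apply/eqP; rewrite -normr_le0; apply/ler_addgt0Pr => e e0.
have A0 : 0 < `|A| + 1 by rewrite ltr_wpDl.
apply: le_trans (h _ (divr_gt0 e0 A0)) _; rewrite add0r mulrCA ler_piMr ?ltW //.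
by rewrite ltr_pdivrMr // mul1r (le_lt_trans (ler_norm A)) // ltrDl.
Qed.

(** Every real relation between the rows of [E] must kill [c]. The phase [u] varies with [eta]: for
    real [theta] one splits [c] into real and imaginary parts, where [u] is a sign; otherwise a
    second relation bounds the component that [u] hides. *)
Lemma rigid_top (c : 'rV[C]_s) : c *m (mq B)^T = theta *: c ->
  exists w : 'rV[C]_d, c = w *m (mc E)^T.
Proof.
move=> cB; suff /submxP : (c <= (mc E)^T)%MS by [].
pose K := (cokermx E^T)^T.
have KE : K *m E = 0 by apply/trmx_inj; rewrite trmx_mul trmxK mulmx_coker trmx0.
have [t0|t0] := eqVneq (Im theta) 0.
  have realcase (cr : 'rV[R]_s) : mc cr *m (mq B)^T = theta *: mc cr -> (mc cr <= (mc E)^T)%MS.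
    move=> crB; apply: kernel_rowspace; apply/matrixP => j k; rewrite ord1 [RHS]mxE -/K.
    have kr : Im ((mc K *m (mc cr)^T) j 0) = 0 by rewrite map_trmx -map_mxM mxE.
    have kr0 : Re ((mc K *m (mc cr)^T) j 0) = 0.
      apply: (@squeeze0 _ 1) => eta eta0; rewrite mul1r.
      have [u [u1 ur uK]] := almost_linear KE crB eta0.
      have := uK j; rewrite ReM kr mulr0 subr0 normrM.
      have Iu : Im u = 0 by apply: ur => //; exists cr.
      suff -> : `|Re u| = 1 by rewrite mul1r.
      have := sqr_cabs u; rewrite u1 Iu expr1n expr0n addr0 => /esym/eqP.
      by rewrite sqrf_eq1 => /orP[] /eqP ->; rewrite ?normrN normr1.
    by move: kr kr0; case: (_ j 0) => x y /= -> ->.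
  pose c1 := map_mx (@complex.Re R) c; pose c2 := map_mx (@complex.Im R) c.
  have cE : c = mc c1 + ('i%C : C) *: mc c2.
    by apply/matrixP => i j; rewrite !mxE; exact: complexE.
  have tE : theta = ((Re theta)%:C)%C by case: (theta) t0 => x y /= ->.
  have [e1 e2] : mc c1 *m (mq B)^T = theta *: mc c1 /\ mc c2 *m (mq B)^T = theta *: mc c2.
    have aux (U W : 'rV[R]_s) : mc U + ('i%C : C) *: mc W = 0 -> U = 0 /\ W = 0.
      move=> /matrixP h; split; apply/matrixP => i j; have := h i j; rewrite !mxE.
        by move=> /(congr1 (@complex.Re R)); rewrite ReD ReM /= !(mul0r, mulr0, subr0, addr0).
      move=> /(congr1 (@complex.Im R)); rewrite ImD ImM /=.
      by rewrite !(mul0r, mulr0, subr0, addr0, add0r, mul1r).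
    have := cB; rewrite {1 2}cE tE -map_mx_real_rat map_trmx mulmxDl -scalemxAl -!map_mxM.
    rewrite scalerDr [_ *: (_ *: _)]scalerA [_ * 'i%C]mulrC -scalerA -!map_mxZ /= => /eqP.
    rewrite -subr_eq0 opprD addrACA -scalerBr -!map_mxB => /eqP/aux[/eqP+ /eqP].
    rewrite !subr_eq0 => /eqP -> /eqP ->; split=> //.
  by rewrite cE addmx_sub ?scalemx_sub ?realcase.
(* [K *m mr B] also annihilates [E] and multiplies the value [z] by [theta]; the real parts of
   [u * z] and [theta * (u * z)] determine [u * z] when [theta] is not real. *)
pose K2 := col_mx K (K *m mr B).
have K2E : K2 *m E = 0.
  by rewrite mul_col_mx -mulmxA -EQ mulmxA KE mul0mx col_mx0.
have K2c : mc K2 *m c^T = col_mx (mc K *m c^T) (theta *: (mc K *m c^T)).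
  rewrite map_col_mx mul_col_mx map_mxM map_mx_real_rat -mulmxA.
  have -> : mq B *m c^T = theta *: c^T.
    by apply/trmx_inj; rewrite trmx_mul trmxK cB [RHS]linearZ /= trmxK.
  by rewrite scalemxAr.
apply: kernel_rowspace; apply/matrixP => j k; rewrite ord1 [RHS]mxE -/K.
set z := (mc K *m c^T) j 0.
have zu eta : 0 < eta -> exists u,
    [/\ cabs u = 1, `|Re (u * z)| <= eta & `|Re (theta * (u * z))| <= eta].
  move=> eta0; have [u [u1 _ uK]] := almost_linear K2E cB eta0.
  exists u; split=> //.
    by have := uK (lshift _ j); rewrite K2c col_mxEu.
  by have := uK (rshift _ j); rewrite K2c col_mxEd mxE mulrCA.
apply: cabs_eq0; apply: (@squeeze0 _ (1 + (1 + `|Re theta|) / `|Im theta|)) => eta eta0.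
have [u [u1 h1 h2]] := zu eta eta0.
have -> : `|cabs z| = cabs (u * z) by rewrite cabsM u1 mul1r ger0_norm ?cabs_ge0.
have It0 : 0 < `|Im theta| by rewrite normr_gt0.
have h3 : `|Im (u * z)| <= (1 + `|Re theta|) / `|Im theta| * eta.
  rewrite mulrAC ler_pdivlMr // -normrM [Im _ * _]mulrC.
  have -> : Im theta * Im (u * z) = Re theta * Re (u * z) - Re (theta * (u * z)).
    by rewrite [Re (theta * _)]ReM; ring.
  rewrite (le_trans (ler_normB _ _)) // normrM.
  have h4 : `|Re theta| * `|Re (u * z)| <= `|Re theta| * eta by rewrite ler_wpM2l.
  by lra.
move: h1 h3; move: (u * z) => v h1 h3; rewrite mulrDl mul1r.
apply: (@le_trans _ _ (`|Re v| + `|Im v|)); last exact: lerD.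
rewrite -(@ler_pXn2r _ 2) ?nnegrE ?cabs_ge0 ?addr_ge0 // sqr_cabs.
rewrite -[Re v ^+ 2]real_normK ?num_real // -[Im v ^+ 2]real_normK ?num_real //.
by rewrite sqrrD addrAC lerDl mulrn_wge0 ?mulr_ge0.
Qed.
End Rigidity.
Section Approximation.
Variables (D0 : nat) (P2 : 'M[C]_s) (lam2 : 'rV[C]_s).
Hypothesis D0_gt0 : (0 < D0)%N.
Hypothesis kap_int : forall x, X x -> forall j, D0%:R * kap x 0 j \is a Num.int.
Hypothesis E_full : row_full E.
Hypothesis P2u : P2 \in unitmx.
Hypothesis P2B : P2 *m (mq B)^T = diag_mx lam2 *m P2.
Hypothesis internal : forall i, cabs (lam2 0 i) < 1 \/
  exists w : 'rV[C]_d, row i P2 = w *m (mc E)^T.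
Local Notation mi := (map_mx (intr : int -> R)).

Lemma internal_coordinate_bound x0 (rho : R) i : X x0 -> exists A : R, 0 <= A /\
  ((cabs (lam2 0 i) < 1 /\ forall x, X x ->
      cabs (ell (row i P2) x - ell (row i P2) x0) <= A) \/
   (forall q : 'rV[rat]_s, `|mr q *m E| <= rho ->
      cabs ((mq q *m (row i P2)^T) 0 0) <= A)).
Proof.
move=> Xx0; have [li|[w wE]] := internal i.
  have [A A0 AP] := internal_bounded li (@ell_diff (row i P2))
    (fun x y => @ellQ _ _ x y (row_eigenvector P2B i)) Xx0.
  by exists A; split=> //; left.
have [A A0 AP] := bounded_mulmx w^T.
exists (A * `|rho|); rewrite mulr_ge0 //; split=> //; right=> q qE.
have -> : mq q *m (row i P2)^T = mc (mr q *m E) *m w^T.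
  by rewrite wE trmx_mul trmxK mulmxA map_mxM map_mx_real_rat.
apply: AP => // k; rewrite mxE cabsR (le_trans (coord_le_norm _ _)) //.
by rewrite (le_trans qE) // ler_norm.
Qed.

Lemma rational_box (M : nat) : exists (T : finType) (Phi : T -> 'rV[rat]_s),
  forall q : 'rV[rat]_s, (forall j, D0%:R * q 0 j \is a Num.int) ->
    (forall j, `|D0%:R * q 0 j| <= M%:R) -> exists tau, q = Phi tau.
Proof.
exists {ffun 'I_s -> 'I_(M + M).+1}.
exists (fun tau : {ffun 'I_s -> 'I_(M + M).+1} => \row_j (((tau j)%:R - M%:R) / D0%:R)) => q qi qM.
have D0n : (D0%:R : rat) != 0 by rewrite pnatr_eq0 -lt0n.
have zP j : exists z : 'I_(M + M).+1, D0%:R * q 0 j = z%:R - M%:R.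
  have /intrP[z zE] := qi j; have := qM j; rewrite zE -intr_norm.
  rewrite -[M%:R]/((M : int)%:~R) ler_int ler_norml => /andP[z1 z2].
  have z0 : 0 <= z + M%:Z by rewrite addrC -lerBlDl sub0r.
  have zM : (absz (z + M%:Z)%R < (M + M).+1)%N.
    by rewrite ltnS -lez_nat gez0_abs // PoszD lerD2r.
  exists (Ordinal zM); rewrite /= -[X in X - _]/((Posz _)%:~R) gez0_abs //.
  by rewrite rmorphD /= addrK.
have [z zE] := choice zP; exists [ffun j => z j].
by apply/rowP => j; rewrite !mxE ffunE -zE mulrAC divff // mul1r.
Qed.

(** In the eigenbasis [P2], the displacement of [y] from a lattice point is bounded independently of
    [ts]: contracted coordinates are bounded on [X] and small on the lattice, the others are
    controlled by [rho]. With denominators dividing [D0], finitely many displacements remain. *)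
Lemma meyer_approximation_coord (rho : R) :
  exists (T : finType) (Phi : T -> V), forall ts : seq 'rV[int]_d,
    exists2 W : 'M[R]_d, W \in unitmx & forall t y, t \in ts -> X y ->
      `|y - mi t *m W| <= rho -> exists tau, y = mi t *m W + Phi tau.
Proof.
have [x0 Xx0 _] := X_rd 0.
have [A AP] := choice (fun i => internal_coordinate_bound (rho + `|x0|) i Xx0).
have A0 i : 0 <= A i by have [] := AP i.
(* The extra 1 leaves room for the lattice point's contribution to the contracted coordinates. *)
pose bd := \sum_i A i + 1.
have bd0 : 0 <= bd by rewrite addr_ge0 // sumr_ge0.
have [Ci Ci0 CiP] := bounded_mulmx (invmx P2^T).
pose M := Num.bound (D0%:R * (Ci * bd)).
have MP : D0%:R * (Ci * bd) <= M%:R by rewrite ltW // archi_boundP // !mulr_ge0.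
have [T [Phi PhiP]] := rational_box M.
exists T, (fun tau => x0 + mr (Phi tau) *m E) => ts.
pose H := mr Cm *m E.
have H_full : row_full H.
  rewrite /row_full eqn_leq rank_leq_col /= -{1}(eqP E_full).
  rewrite -[in X in (X <= _)%N](mul1mx E) -(map_mx1 (ratr : rat -> R)) -DC.
  by rewrite map_mxM -mulmxA mxrankM_maxr.
pose f := fullrankfun H_full.
pose av j := a (f j); pose bv j := b (f j).
have Xa j : X (av j) by have [] := Xab (f j).
have Xb j : X (bv j) by have [] := Xab (f j).
(* Rows of [H] forming a basis of the space, pushed forward by [Q^k]. *)
pose W k : 'M[R]_d := \matrix_j iter k (linQ Q) (av j - bv j).
have Wu k : W k \in unitmx.
  elim: k => [|k IH].
    have -> : W 0%N = rowsub f H.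
      apply/row_matrixP => j; rewrite rowK row_rowsub /av /bv /=.
      by have [_ _ ->] := Xab (f j).
    exact: fullrowsub_unit.
  have -> : W k.+1 = W k *m Q^T by apply/row_matrixP => j; rewrite row_mul !rowK.
  by rewrite unitmx_mul IH unitmx_tr (unit_of_lam Pu PQ lam1).
pose e i j := cabs (ell (row i P2) (av j) - ell (row i P2) (bv j)).
(* Coordinates that are not contracted get ratio 0 here; [q_small] bounds them instead. *)
pose ra i := if cabs (lam2 0 i) < 1 then cabs (lam2 0 i) else 0.
pose co i := \sum_(t <- ts) \sum_j `|(t 0 j)%:~R| * e i j.
have [|||k /(_ k (leqnn k)) kP] := @geometric_small R _ ra co 1.
- exact: ltr01.
- by move=> i; rewrite /ra; case: ifP => [->|_]; rewrite ?cabs_ge0 // lexx ltr01.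
- by move=> i; apply: sumr_ge0 => t _; apply: sumr_ge0 => j _; rewrite mulr_ge0 // cabs_ge0.
exists (W k) => // t y tts Xy yW.
pose g j := kap (iter k (linQ Q) (av j)) - kap (iter k (linQ Q) (bv j)).
pose q := kap y - kap x0 - \sum_j (t 0 j)%:~R *: g j.
have Xk x : X x -> X (iter k (linQ Q) x) by exact: X_iter.
have qE : mr q *m E = y - x0 - mi t *m W k.
  rewrite map_mxB mulmxBl -kapE //; congr (_ - _).
  rewrite [RHS]mulmx_sum_row [mr (\sum_j _)]raddf_sum mulmx_suml; apply: eq_bigr => j _.
  rewrite /= map_mxZ -scalemxAl rmorph_int mxE rowK iter_linQB -kapE //; exact: Xk.
have q_int j : D0%:R * q 0 j \is a Num.int.
  rewrite !mxE !mulrBr summxE mulr_sumr !rpredB ?kap_int //; apply: rpred_sum => i _.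
  rewrite !mxE mulrCA mulrBr rpredM ?intr_int // rpredB // kap_int //; exact: Xk.
have q_small : `|mr q *m E| <= rho + `|x0|.
  by rewrite qE addrAC (le_trans (ler_normB _ _)) // lerD2r.
have qi i : cabs ((mq q *m (row i P2)^T) 0 0) <= bd.
  rewrite /bd (bigD1 i) //= -addrA.
  have rest0 : 0 <= \sum_(j | j != i) A j by exact: sumr_ge0.
  have [_ [[li Ai]|Ai]] := AP i; last first.
    by apply: le_trans (Ai _ q_small) _; rewrite lerDl addr_ge0.
  have -> : (mq q *m (row i P2)^T) 0 0 =
      ell (row i P2) y - ell (row i P2) x0 -
      \sum_j ((t 0 j)%:~R * lam2 0 i ^+ k) * (ell (row i P2) (av j) - ell (row i P2) (bv j)).
    rewrite ellB map_mxB mulmxBl [LHS]mxE [X in _ + X]mxE; congr (_ - _).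
    rewrite [mq (\sum_j _)]raddf_sum mulmx_suml summxE; apply: eq_bigr => j _.
    rewrite /= map_mxZ -scalemxAl mxE rmorph_int -mulrA; congr (_ * _).
    rewrite -ellB (ell_iter XQ (theta := lam2 0 i)) //.
    by move=> x x' Xx Xx'; apply: ellQ => //; exact: row_eigenvector.
  rewrite (le_trans (cabsD _ _)) // lerD ?Ai // cabsN.
  apply: (@le_trans _ _ 1); last by rewrite lerDr.
  have := kP i; rewrite /ra li; apply: le_trans.
  rewrite (le_trans (cabs_sum _ _ _)) // /co (big_rem _ tts) /= mulrDl ler_wpDr //.
    rewrite mulr_ge0 ?exprn_ge0 ?cabs_ge0 //; apply: sumr_ge0 => t' _.
    by apply: sumr_ge0 => j _; rewrite mulr_ge0 // cabs_ge0.
  rewrite mulr_suml; apply: ler_sum => j _; rewrite !cabsM cabsX mulrAC.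
  by rewrite -(rmorph_int (real_complex R)) cabsR.
have q_box j : `|D0%:R * q 0 j| <= M%:R.
  have h : cabs (mq q 0 j) <= Ci * bd.
    rewrite -[mq q](mulmxK (_ : P2^T \in unitmx)) ?unitmx_tr //; apply: CiP => // i.
    have -> : (mq q *m P2^T) 0 i = (mq q *m (row i P2)^T) 0 0; last exact: qi.
    by rewrite [LHS]mxE [RHS]mxE; apply: eq_bigr => l _; rewrite !mxE.
  rewrite -(ler_rat R) ratr_nat; apply: le_trans MP.
  rewrite -map_mx_real_rat mxE cabsR mxE in h.
  by rewrite ratr_norm rmorphM /= normrM ratr_nat normr_nat ler_wpM2l.
have [tau tauE] := PhiP q q_int q_box; exists tau.
rewrite -tauE qE; move: (mi t *m W k) => z.
by apply/matrixP => i j; rewrite !mxE; ring.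
Qed.
End Approximation.
End Coordinates.
End MeyerProperty.

Lemma expanding_diagonal (R : realType) d (Q : 'M[R]_d) (P : 'M[R[i]]_d) lam :
  expanding Q -> P \in unitmx -> P *m mxC Q = diag_mx lam *m P ->
  forall j, 1 < cabs (lam 0 j).
Proof.
move=> Q_exp Pu PQ j; have := Q_exp _ (diagonal_eigenvalue Pu PQ j).
by rewrite cabsE -(rmorph1 (real_complex R)) ltcR.
Qed.

(** The order of quantifiers matters: the displacements [Phi] are fixed before the list [ts], and
    only the lattice [W] depends on it. They can therefore serve as colours for Gallai's theorem. *)
Theorem meyer_approximation (R : realType) (d : nat) (Q : 'M[R]_d) (X : set 'rV[R]_d) (r : R) :
  0 <= r -> (forall z, exists2 x, X x & `|x - z| <= r) ->
  (forall rho : R, finite_set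
     [set v | `|v| <= rho /\ exists x y, [/\ X x, X y & v = x - y]]) ->
  (forall x, X x -> X (linQ Q x)) ->
  (forall F : seq 'rV[R]_d, (forall a, a \in F -> X a) ->
     exists r' : R, forall z, exists2 v, `|v - z| <= r' & forall a, a \in F -> X (a + v)) ->
  expanding Q -> diagonalizable (mxC Q) ->
  (forall z w, spec Q z -> spec Q w -> alg_conj z w /\
     mup z (char_poly (mxC Q)) = mup w (char_poly (mxC Q))) ->
  pisot_family (spec Q) ->
  forall rho : R, exists (T : finType) (Phi : T -> 'rV[R]_d), forall ts : seq 'rV[int]_d,
    exists2 W : 'M[R]_d, W \in unitmx & forall t y, t \in ts -> X y ->
      `|y - map_mx intr t *m W| <= rho -> exists tau, y = map_mx intr t *m W + Phi tau.
Proof.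
move=> r0 X_rd X_fin XQ X_rep Q_exp dQ Q_conj Q_pisot rho.
(* In dimension 0 there is no eigenvalue of maximal modulus to select, and all vectors coincide. *)
have [d0|[j0 _]] : d = 0%N \/ exists j : 'I_d, true.
  by case: (d) => [|d']; [left|right; exists ord0].
  exists unit, (fun=> 0) => ts; exists 1%:M; first exact: unitmx1.
  move=> t y _ _ _; exists tt; apply/rowP => j; have := ltn_ord j.
  by rewrite [X in (_ < X)%N]d0.
have [P [lam [Pu PQ]]] := diagonalizable_rows dQ.
have lam1 := expanding_diagonal Q_exp Pu PQ.
pose jm := [arg max_(j > j0) cabs (lam 0 j)]%O.
have top j : cabs (lam 0 j) <= cabs (lam 0 jm) by rewrite /jm; case: arg_maxP => // i _; exact.
have [s [p [E [B [D0 [a [b [Cm [Dm [E_ind EQ [D00 Eint] [Xab DC] E_full]]]]]]]]]] :=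
  difference_lattice r0 X_rd X_fin XQ.
case: s => [|s] in E B Cm Dm E_ind EQ Eint Xab DC E_full *.
  have := rank_leq_row E; rewrite (eqP E_full) leqNgt.
  by rewrite (leq_ltn_trans (leq0n _) (ltn_ord j0)).
have [x0 Xx0 _] := X_rd 0.
have kapP x : exists q : 'rV[rat]_s.+1, X x -> x - x0 = map_mx ratr q *m E /\
    forall j, D0%:R * q 0 j \is a Num.int.
  have [Xx|nXx] := pselect (X x); last by exists 0.
  by have [q qP] := Eint _ _ Xx Xx0; exists q.
have [kap kapE] := choice kapP.
have kapB x y : X x -> X y -> x - y = map_mx ratr (kap x - kap y) *m E.
  move=> /kapE[xE _] /kapE[yE _]; rewrite map_mxB mulmxBl -xE -yE.
  by rewrite opprB addrA subrK.
have rigid := rigid_top r0 X_rd X_fin XQ X_rep Pu PQ lam1 E_ind EQ kapB Xab DC (lam1 jm) top.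
have [P2 [lam2 [P2u P2B internal]]] :=
  internal_eigenvectors Pu PQ E_ind EQ E_full Q_conj Q_pisot rigid.
have kap_int x : X x -> forall j, D0%:R * kap x 0 j \is a Num.int by move=> /kapE[].
exact: (meyer_approximation_coord r0 X_rd X_fin XQ Pu PQ lam1 E_ind EQ kapB Xab DC
  D00 kap_int E_full P2u P2B internal).
Qed.

(** * Translates of tiles, separated sets and compact boxes *)

Section Translates.
Context {R : realType} {d : nat}.
Local Notation V := 'rV[R]_d.
Implicit Types (T : @tile R d) (P : set (@tile R d)) (x y z : V).

Lemma tile_trD T x y : tile_tr (tile_tr T x) y = tile_tr T (x + y).
Proof.
rewrite /tile_tr /=; congr Tile; apply/seteqP; split => z /=.
  by move=> [_ [w Tw <-] <-]; exists w; rewrite // addrA.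
by move=> [w Tw <-]; exists (w + x); [exists w|rewrite addrA].
Qed.

Lemma tile_tr0 T : tile_tr T 0 = T.
Proof.
case: T => l A; rewrite /tile_tr /=; congr Tile; apply/seteqP; split => z /=.
  by move=> [w Tw <-]; rewrite addr0.
by move=> Az; exists z; rewrite // addr0.
Qed.

Lemma patch_tr_mem P x T : P T -> patch_tr P x (tile_tr T x).
Proof. by move=> PT; exists T. Qed.

Lemma tile_bounded T : is_tile T -> exists2 M : R, 0 < M & forall z, tsupp T z -> `|z| <= M.
Proof.
move=> [/compact_bounded cT _]; have [M M0 MP] := ex_strict_bound_gt0 cT.
by exists M => // z /MP /ltW.
Qed.

(** A bounded nonempty support is not invariant under a nonzero translation. *)
Lemma tile_tr_inj T x y : is_tile T -> tsupp T !=set0 ->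
  tile_tr T x = tile_tr T y -> x = y.
Proof.
move=> /tile_bounded[M M0 MT] [q Tq] /(congr1 tsupp) /= xy.
have step z : tsupp T z -> tsupp T (z + (x - y)).
  move=> Tz; have : ((fun w => w + y) @` tsupp T) (z + x) by rewrite -xy; exists z.
  by move=> [w Tw wz]; rewrite addrA -wz addrK.
have iter_step n : tsupp T (q + (x - y) *+ n).
  elim: n => [|n IH]; first by rewrite addr0.
  by rewrite mulrSr addrA; exact: step.
apply/eqP; rewrite -subr_eq0 -normr_eq0; apply/negPn/negP => xy0.
have xy1 : 0 < `|x - y| by rewrite lt_neqAle eq_sym xy0 normr_ge0.
have h : (2 * M) / `|x - y| < (Num.bound ((2 * M) / `|x - y|))%:R.
  by apply: archi_boundP; rewrite divr_ge0 // mulr_ge0 // ltW.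
have : `|(x - y) *+ Num.bound ((2 * M) / `|x - y|)| <= M + M.
  rewrite -[(x - y) *+ _](addKr q) addrC (le_trans (ler_normB _ _)) // lerD //.
    exact/MT/iter_step.
  exact: MT.
rewrite normrMn -[_ *+ Num.bound _]mulr_natr leNgt => /negP; apply.
move: h; rewrite ltr_pdivrMr // [ltRHS]mulrC => h; lra.
Qed.

Lemma tile_interior_ball T : is_tile T -> tsupp T !=set0 ->
  exists q (e : R), [/\ 0 < e, tsupp T q & forall u x, `|x - (q + u)| < e ->
    interior (tsupp (tile_tr T u)) x].
Proof.
move=> [_ cT] [z Tz].
have [q Iq] : interior (tsupp T) !=set0.
  apply/set0P/eqP => I0; move: Tz; rewrite -cT I0 closure0 //.
have /nbhs_ballP[e /= e0 eP] : nbhs q (tsupp T) by [].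

exists q, e; split=> // [|u x xq]; first exact: interior_subset.
apply/nbhs_ballP; exists (e - `|x - (q + u)|); rewrite /= ?subr_gt0 // => w.
rewrite -ball_normE /= => xw; exists (w - u); last by rewrite subrK.
apply: eP; rewrite -ball_normE /=.
have -> : q - (w - u) = - (x - (q + u)) + (x - w) by apply/matrixP => i j; rewrite !mxE; ring.
by rewrite (le_lt_trans (ler_normD _ _)) // normrN -ltrBrDl.
Qed.

(** A cubic grid of side [e / 2] has at most one point of [A] in each cell. *)
Lemma separated_finite (A : set V) (e rho : R) z : 0 < e ->
  (forall x y, A x -> A y -> x <> y -> e <= `|x - y|) ->
  (forall x, A x -> `|x - z| <= rho) -> finite_set A.
Proof.
move=> e0 sep bd.
have [Ax1|noA] := pselect (exists x, A x); last first.
  by rewrite (_ : A = set0) //; apply/seteqP; split=> // x Ax; case: noA; exists x.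
have rho0 : 0 <= rho by have [x Ax] := Ax1; exact: le_trans (bd x Ax).
pose N := Num.truncn (4 * rho / e).
pose cell x j : R := (x 0 j - z 0 j + rho) * (2 / e).
have cellP x j : A x -> 0 <= cell x j <= 4 * rho / e.
  move=> /bd xz; have := le_trans (coord_le_norm _ j) xz.
  rewrite !mxE ler_norml => /andP[h1 h2].
  have e2 : 0 <= 2 / e by rewrite divr_ge0 // ltW.
  rewrite mulr_ge0 //=; last by lra.
  have -> : 4 * rho / e = (2 * rho) * (2 / e) by field; rewrite gt_eqF.
  by rewrite ler_wpM2r //; lra.
pose g x : {ffun 'I_d -> 'I_N.+1} := [ffun j => inord (Num.truncn (cell x j))].
have ginj x y : A x -> A y -> g x = g y -> x = y.
  move=> Ax Ay gxy; apply: contrapT => nxy; have := sep _ _ Ax Ay nxy.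
  rewrite leNgt => /negP; apply; apply: (@le_lt_trans _ _ (e / 2)); last first.
    by rewrite ltr_pdivrMr // ltr_pMr // ltr1n.
  apply: norm_le_coord => [|j]; first by rewrite divr_ge0 // ltW.
  have tle w : A w -> (Num.truncn (cell w j) < N.+1)%N.
    by move=> Aw; rewrite ltnS; apply: le_truncn; have /andP[_] := cellP w j Aw.
  have := congr1 (fun f : {ffun 'I_d -> 'I_N.+1} => nat_of_ord (f j)) gxy.
  rewrite !ffunE !inordK ?tle // => txy.
  have /andP[cx0 _] := cellP x j Ax; have /andP[cy0 _] := cellP y j Ay.
  have := truncn_itv cx0; have := truncn_itv cy0; rewrite -txy -natr1.
  move=> /andP[h1 h2] /andP[h3 h4].
  have : `|cell x j - cell y j| <= 1 by rewrite ler_norml; lra.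
  have -> : cell x j - cell y j = (x - y) 0 j * (2 / e) by rewrite /cell !mxE; ring.
  have e2 : 0 < 2 / e by rewrite divr_gt0.
  by rewrite normrM (gtr0_norm e2) -ler_pdivlMr // div1r invf_div.
pose h (f : {ffun 'I_d -> 'I_N.+1}) : V := xget 0 [set x | A x /\ g x = f].
apply: (@sub_finite_set _ _ (h @` setT)); last exact/finite_image/finite_finset.
move=> x Ax; exists (g x) => //; rewrite /h; case: xgetP => [y _ [Ay gy]|/(_ x) []] //.
exact: ginj.
Qed.

Lemma closed_box_compact (K : R) : compact [set x : V | `|x| <= K].
Proof.
have -> : [set x : V | `|x| <= K] =
    if 0 <= K then [set v | forall i : 'I_d, (`[- K, K]%classic : set R) (v ord0 i)] else set0.
  apply/seteqP; split => x /=.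
    move=> xK; have -> /= : 0 <= K by exact: le_trans xK.
    by move=> i; rewrite /= in_itv /= -ler_norml (le_trans (coord_le_norm _ _)).
  case: ifP => //= K0 xK; apply: norm_le_coord => // j.
  by have := xK j; rewrite /= in_itv /= -ler_norml.
case: ifP => _; last exact: compact0.
apply: (@rV_compact R d (fun=> `[- K, K]%classic)) => i; exact: segment_compact.
Qed.
End Translates.

(** * Control points of a self-affine tiling *)

Section ControlPoints.
Context {R : realType} {d m : nat}.
Local Notation V := 'rV[R]_d.
Variables (S : @subst_rule R d m) (Tg : set (@tile R d)).
Hypothesis subS : is_subst S.
Hypothesis primS : primitive S.
Hypothesis TgS : self_affine_tiling S Tg.
Local Notation Q := (expo S).

Let proto_tile i : is_tile (proto S i). Proof. by have [] := subS. Qed.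

(** [is_tile] admits the empty set. An empty prototile inflates to an empty support, so by
    primitivity emptiness would spread to every prototile, against the covering of the space. *)
Lemma proto_empty k i j : (subst_mx S ^+ k) i j != 0 ->
  tsupp (proto S j) = set0 -> tsupp (proto S i) = set0.
Proof.
elim: k j => [|k IH] j.
  by rewrite expr0 -[1]/(1%:M) mxE; case: (i =P j) => [->|]; rewrite ?eqxx.
rewrite exprSr -[_ * _]/(_ *m _) mxE => Aij j0.
have [l /andP[]] : exists l, ((subst_mx S ^+ k) i l != 0) && (subst_mx S l j != 0).
  apply: contrapT => nol; move: Aij; rewrite big1 ?eqxx // => l _.
  apply/eqP; rewrite mulf_eq0; apply/negPn/negP; rewrite negb_or => h.
  by apply: nol; exists l.
move=> /IH + lj; apply.
have /hasP[p pj /eqP pl] : has (fun p : 'I_m * V => p.1 == l) (omega S j).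
  by rewrite has_count; move: lj; rewrite mxE; case: count.
have [_ _ _ /(_ j)[_ _ sj]] := subS.
rewrite -subset0 => z zl.
suff : patch_supp (omega_patch S j) (z + p.2) by rewrite sj j0 image_set0.
exists (tile_tr (proto S p.1) p.2); first by exists p.
by exists z; rewrite // pl.
Qed.

Lemma proto_nonempty i : tsupp (proto S i) !=set0.
Proof.
have [[_ cover] Tgi _ _ _] := TgS.
have : patch_supp Tg 0 by rewrite cover.
move=> [T TT]; have [i0 [x ->]] := Tgi _ TT; move=> [q qT _].
apply/set0P/negP => /eqP i_empty; have [k [_ kP]] := primS.
have := @proto_empty k i0 i; rewrite gt_eqF // => /(_ isT i_empty) h.
by move: qT; rewrite h.
Qed.

Lemma omega_nonempty i : exists p, p \in omega S i.
Proof.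
have [_ _ _ /(_ i)[_ _ si]] := subS; have [z zi] := proto_nonempty i.
have : patch_supp (omega_patch S i) (linQ Q z) by rewrite si; exists z.
by move=> [T [p pi _] _]; exists p.
Qed.

Lemma repetitive_bound (P : set (@tile R d)) T :
  finite_set P -> legal Tg P -> P T -> tsupp T !=set0 ->
  exists r : R, forall z, exists2 y, `|y - z| <= r & patch_tr P y `<=` Tg.
Proof.
move=> finP legP PT [q Tq]; have [_ _ _ _ rep] := TgS.
have [r [r0 rP]] := rep P finP legP; exists (r + `|q|) => z.
have [y [yT yb]] := rP z; exists y => //.
have : patch_supp (patch_tr P y) (q + y).
  by exists (tile_tr T y); [exact: patch_tr_mem|exists q].
move=> /yb; rewrite -ball_normE /= => h.
have -> : y - z = - (z - (q + y)) - q by apply/matrixP => i j; rewrite !mxE; ring.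
by rewrite (le_trans (ler_normB _ _)) // normrN lerD // ltW.
Qed.

Variables (P : 'M[R[i]]_d) (lam : 'rV[R[i]]_d).
Hypothesis Pu : P \in unitmx.
Hypothesis PQ : P *m mxC Q = diag_mx lam *m P.
Hypothesis lam1 : forall j, 1 < cabs (lam 0 j).

(** [pi] selects a tile in the image of each prototile. The linear system for control points
    compatible with this choice is invertible because [Q] expands while the selection merely
    permutes or repeats rows. *)
Lemma control_vectors (pi : 'I_m -> 'I_m * V) :
  exists a : 'I_m -> V, forall i, linQ Q (a i) = a (pi i).1 + (pi i).2.
Proof.
pose Pm : 'M[R]_m := \matrix_(i, j) (j == (pi i).1)%:R.
have PmE n (A : 'M[R]_(m, n)) i : row i (Pm *m A) = row (pi i).1 A.
  rewrite row_mul; have -> : row i Pm = delta_mx 0 (pi i).1.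
    by apply/rowP => j; rewrite !mxE eqxx.
  by rewrite -rowE.
pose N := lin_mulmxr Q^T - lin_mulmx Pm.
have NE (A : 'M[R]_(m, d)) : mxvec A *m N = mxvec (A *m Q^T - Pm *m A).
  by rewrite mulmxBr !mul_vec_lin linearB.
have Nu : N \in unitmx.
  rewrite -row_free_unit -kermx_eq0; apply/eqP/row_matrixP => k; rewrite row0.
  set v := row k _; have : v *m N = 0 by rewrite -row_mul mulmx_ker row0.
  rewrite -(vec_mxK v) NE; set A := vec_mx v => /(canRL mxvecK).
  rewrite linear0 => /eqP; rewrite subr_eq0 => /eqP AQ.
  suff -> : A = 0 by rewrite linear0.
  have rowA i : linQ Q (row i A) = row (pi i).1 A.
    by rewrite /linQ -row_mul AQ PmE.
  apply/row_matrixP => i; rewrite row0; apply/eqP; rewrite -normr_le0.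
  have [C C0 CP] := norm_evec_bound Pu.
  have := CP (row i A) 0 (lexx 0); rewrite mulr0; apply=> j.
  (* At the row of largest coordinate, multiplication by [lam 0 j] produces the coordinate of
     another row, which is no larger; so it vanishes. *)
  pose i1 := [arg max_(i' > i) cabs (evec P (row i' A) 0 j)]%O.
  have i1P i' : cabs (evec P (row i' A) 0 j) <= cabs (evec P (row i1 A) 0 j).
    by rewrite /i1; case: arg_maxP => // i2 _; exact.
  apply: le_trans (i1P i) _; have := i1P (pi i1).1.
  rewrite -rowA (evec_linQ PQ) cabsM leNgt => h; rewrite leNgt; apply/negP => h0.
  by move: h; rewrite ltr_pMl // lam1.
pose Y : 'M[R]_(m, d) := \matrix_i (pi i).2.
pose A := vec_mx (mxvec Y *m invmx N) : 'M[R]_(m, d).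
have AE : A *m Q^T - Pm *m A = Y.
  by apply: (can_inj mxvecK); rewrite -NE vec_mxK mulmxKV.
exists (fun i => row i A) => i.
have := congr1 (row i) AE; rewrite linearB /= row_mul PmE rowK => <-.
by rewrite addrC subrK.
Qed.

Variables (pi : 'I_m -> 'I_m * V) (a : 'I_m -> V).
Hypothesis pi_omega : forall i, pi i \in omega S i.
Hypothesis aQ : forall i, linQ Q (a i) = a (pi i).1 + (pi i).2.

Definition control_points : set V :=
  [set z | exists i x, Tg (tile_tr (proto S i) x) /\ z = x + a i].

Local Notation X := control_points.

(** The inflated control point is the control point of the selected tile in the inflated tile. *)
Lemma control_pointsQ z : X z -> X (linQ Q z).
Proof.
move=> [i [x [Tx ->]]]; exists (pi i).1, ((pi i).2 + linQ Q x); split.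
  have [_ _ TgE _ _] := TgS; rewrite -TgE; exists i, x, (pi i); split=> //.
by rewrite /linQ mulmxDl -[a i *m _]/(linQ Q (a i)) aQ [a _ + _]addrC addrA [_ + (pi i).2]addrC.
Qed.

Lemma control_points_repetitive (F : seq V) : (forall z, z \in F -> X z) ->
  exists r : R, forall z, exists2 v, `|v - z| <= r & forall x, x \in F -> X (x + v).
Proof.
move=> FX; case: F => [|z0 F] in FX *.
  by exists 0 => z; exists z; rewrite ?subrr ?normr0.
have /choice[c cP] : forall z, exists c : 'I_m * V, z \in z0 :: F ->
    Tg (tile_tr (proto S c.1) c.2) /\ z = c.2 + a c.1.
  move=> z; have [zF|zF] := boolP (z \in z0 :: F); last first.
    by have [i [x _]] := FX z0 (mem_head _ _); exists (i, x).
  by have [i [x xP]] := FX z zF; exists (i, x).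
pose tl z := tile_tr (proto S (c z).1) (c z).2.
pose Pt : set (@tile R d) := tl @` [set` z0 :: F].
have finPt : finite_set Pt by exact/finite_image/finite_seq.
have legPt : legal Tg Pt.
  exists 0 => T [_ [z zF <-] <-]; rewrite tile_tr0; by have [] := cP z zF.
have Pt0 : Pt (tl z0) by exists z0 => //; exact: mem_head.
have [q qs] := proto_nonempty (c z0).1.
have [|r rP] := repetitive_bound finPt legPt Pt0; first by exists (q + (c z0).2), q.
exists r => z; have [v vz vT] := rP z; exists v => // x xF.
exists (c x).1, ((c x).2 + v); split.
  by rewrite -tile_trD; apply: vT; apply: patch_tr_mem; exists x.
by have [_ {1}->] := cP x xF; rewrite addrAC.
Qed.

Lemma control_points_dense : exists2 r : R, 0 <= r & forall z, exists2 x, X x & `|x - z| <= r.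
Proof.
have [[_ cover] Tgi _ _ _] := TgS.
have : patch_supp Tg 0 by rewrite cover.
move=> [T TT]; have [i [x xE]] := Tgi _ TT; rewrite xE in TT * => _.
have Xx : X (x + a i) by exists i, x.
have [|r rP] := @control_points_repetitive [:: x + a i].
  by move=> z; rewrite inE => /eqP->.
exists `|r| => // z; have [v vz vX] := rP (z - (x + a i)).
exists (x + a i + v); first by apply: vX; exact: mem_head.
have -> : x + a i + v - z = v - (z - (x + a i)) by apply/matrixP => ? ?; rewrite !mxE; ring.
exact: le_trans vz (ler_norm r).
Qed.

Lemma control_points_locally_finite (rho : R) z : finite_set [set x | X x /\ `|x - z| <= rho].
Proof.
pose A i : set V := [set x | Tg (tile_tr (proto S i) x) /\ `|x - (z - a i)| <= rho].
have finA i : finite_set (A i).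
  have [q [e [e0 qs qe]]] := tile_interior_ball (proto_tile i) (proto_nonempty i).
  apply: (@separated_finite _ _ _ e rho (z - a i)) => // [x y [Tx _] [Ty _] nxy|x []] //.
  rewrite leNgt; apply/negP => xy; have [[[_ disj] _] _ _ _ _] := TgS.
  have nT : tile_tr (proto S i) x <> tile_tr (proto S i) y.
    by move=> /(tile_tr_inj (proto_tile i) (proto_nonempty i)).
  suff : set0 (q + x) by [].
  rewrite -(disj _ _ Tx Ty nT); split; apply: qe; rewrite ?subrr ?normr0 //.
  by rewrite opprD addrACA subrr add0r.
apply: (@sub_finite_set _ _ (\bigcup_(i in [set: 'I_m]) ((fun x => x + a i) @` A i))).
  move=> _ [[i [x [Tx ->]]] xz]; exists i => //; exists x => //; split=> //.
  by rewrite opprB addrA.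
by apply: bigcup_finite => [|i _]; [exact: finite_finset|exact: finite_image].
Qed.

(** Close pairs of tiles lie in windows with finitely many patches up to translation; each pair is
    moved to a fixed occurrence of its patch, where local finiteness applies. *)
Lemma control_points_fin (rho : R) :
  finite_set [set v : V | `|v| <= rho /\ exists x y, [/\ X x, X y & v = x - y]].
Proof.
have [_ _ _ flc _] := TgS.
have /choice[q qP] : forall i, exists q, tsupp (proto S i) q by move=> i; exact: proto_nonempty.
have /choice[M MP] : forall i, exists M, 0 < M /\ forall z, tsupp (proto S i) z -> `|z| <= M.
  by move=> i; have [M M0 MP] := tile_bounded (proto_tile i); exists M.
(* A window of radius [K0] around one control point meets each tile whose control point is within
   [rho]; conversely [rho'] bounds the control points of the tiles it meets. *)
pose K0 := \sum_i `|q i - a i| + `|rho|.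
pose rho' := K0 + \sum_i (M i + `|a i|).
have bound_i (f : 'I_m -> R) i : (forall j, 0 <= f j) -> f i <= \sum_j f j.
  by move=> f0; rewrite (bigD1 i) //= lerDl; exact: sumr_ge0.
pose K : set V := [set x | `|x| <= K0].
have [N [G GP]] := flc K (@closed_box_compact R d K0).
have near_tile i u x : Tg (tile_tr (proto S i) u) -> `|u + a i - x| <= `|rho| ->
    patch_meet Tg ((fun y => y + x) @` K) (tile_tr (proto S i) u).
  move=> Tu ux; split=> //; exists (q i + u); split; first by exists (q i).
  exists (q i + u - x); last by rewrite subrK.
  have -> : q i + u - x = (q i - a i) + (u + a i - x) by apply/matrixP => ? ?; rewrite !mxE; ring.
  rewrite /K /= /K0 (le_trans (ler_normD _ _)) // lerD //.
  exact: (bound_i (fun j => `|q j - a j|)).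
have meet_near i u x : patch_meet Tg ((fun y => y + x) @` K) (tile_tr (proto S i) u) ->
    `|u + a i - x| <= rho'.
  move=> [_ [_ [[s si <-] [w wK wE]]]].
  have -> : u + a i - x = w + (a i - s).
    have -> : w = s + u - x by rewrite -wE addrK.
    by apply/matrixP => ? ?; rewrite !mxE; ring.
  rewrite (le_trans (ler_normD _ _)) // lerD // (le_trans (ler_normB _ _)) //.
  rewrite addrC; have [_ h] := MP i; apply: le_trans (lerD (h _ si) (lexx _)) _.
  apply: (bound_i (fun j => M j + `|a j|)) => j; have [Mj _] := MP j.
  by rewrite addr_ge0 // ltW.
(* One window centre for each class of patches; the default 0 stands for classes that do not
   occur. *)
have /choice[xk xkP] : forall k, exists xk : V, (exists x t,
    patch_meet Tg ((fun y => y + x) @` K) = patch_tr (G k) t) ->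
    exists t, patch_meet Tg ((fun y => y + xk) @` K) = patch_tr (G k) t.
  move=> k; have [[x xt]|nx] := pselect (exists x t,
    patch_meet Tg ((fun y => y + x) @` K) = patch_tr (G k) t); first by exists x.
  by exists 0.
pose L k := [set x | X x /\ `|x - xk k| <= rho'].
apply: (@sub_finite_set _ _ (\bigcup_(k in `I_N)
   [set x - y | x in L k & y in L k])); last first.
  apply: bigcup_finite => [|k _]; first exact: finite_II.
  by apply: finite_image2; exact: control_points_locally_finite.
move=> v [v_rho [x1 [y1 [[i [u [Tu x1E]]] [j [w [Tw y1E]]] vE]]]].
rewrite vE x1E y1E in v_rho *.
pose x := u + a i.
have [|k [t [kN kE]]] := GP (patch_meet Tg ((fun y => y + x) @` K)); first by exists x.
have [|t' k'E] := xkP k; first by exists x, t.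
exists k => //.
have shift i' u' : patch_meet Tg ((fun y => y + x) @` K) (tile_tr (proto S i') u') ->
    L k (u' + a i' - t + t').
  rewrite kE => -[T GT TE].
  have T'E : tile_tr T t' = tile_tr (proto S i') (u' - t + t').
    by rewrite -tile_trD -tile_trD -TE [tile_tr (tile_tr T t) _]tile_trD subrr tile_tr0.
  have mT : patch_meet Tg ((fun y => y + xk k) @` K) (tile_tr (proto S i') (u' - t + t')).
    by rewrite k'E -T'E; exact: patch_tr_mem.
  have e : u' + a i' - t + t' = u' - t + t' + a i' by apply/matrixP => ? ?; rewrite !mxE; ring.
  split; last by rewrite e; exact: meet_near.
  by exists i', (u' - t + t'); split=> //; case: mT.
exists (u + a i - t + t').
  by apply/shift/near_tile => //; rewrite subrr normr0.
exists (w + a j - t + t').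
  by apply/shift/near_tile => //; rewrite distrC (le_trans v_rho) // ler_norm.
by apply/matrixP => ? ?; rewrite !mxE; ring.
Qed.
End ControlPoints.

(** * Combination of the lattice approximation with Gallai's theorem *)

Theorem theorem2p15 (R : realType) (d m : nat) (S : @subst_rule R d m)
    (Tg : set (@tile R d)) :
  is_subst S -> primitive S -> subst_FLC S ->
  self_affine_tiling S Tg ->
  diagonalizable (mxC (expo S)) ->
  (forall z w, spec (expo S) z -> spec (expo S) w ->
     alg_conj z w /\
     mup z (char_poly (mxC (expo S))) = mup w (char_poly (mxC (expo S)))) ->
  pisot_family (spec (expo S)) ->
  forall P : set (@tile R d), finite_set P -> legal Tg P ->
  forall n : nat, (0 < n)%N ->
  exists b : 'I_d -> 'rV[R]_d,
    (\matrix_(j < d) b j) \in unitmx /\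
    legal Tg [set T | exists l : {ffun 'I_d -> 'I_n},
                patch_tr P (\sum_(j < d) ((l j).+1)%:R *: b j) T].
Proof.
move=> subS primS _ TgS dQ Q_conj Q_pisot P finP legP n n0.
have [[T0 PT0]|noP] := pselect (exists T, P T); last first.
  (* For the empty patch any basis serves. *)
  exists (fun j => delta_mx 0 j); split.
    rewrite (_ : \matrix_j _ = 1%:M) ?unitmx1 //.
    by apply/matrixP => i j; rewrite !mxE eqxx eq_sym.
  by exists 0 => T1 [T2 [l [T PT _]] _]; case: noP; exists T.
have [_ _ Q_exp _] := subS.
have [U [lam [Uu UQ]]] := diagonalizable_rows dQ.
have lam1 := expanding_diagonal Q_exp Uu UQ.
have [pi pi_omega] := choice (omega_nonempty subS primS TgS).
have [a aQ] := control_vectors Uu UQ lam1 pi.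
have [r r0 X_rd] := control_points_dense subS primS TgS a.
have [y0 y0P] := legP.
have [_ Tgi _ _ _] := TgS.
have [i [x T0E]] := Tgi _ (y0P _ (patch_tr_mem y0 PT0)).
have T0x y : tile_tr T0 y = tile_tr (proto S i) (x - y0 + y).
  by rewrite -[RHS]tile_trD -[tile_tr _ (x - y0)]tile_trD -T0E !tile_trD addrA subrr add0r.
have T0_ne : tsupp T0 !=set0.
  have [q qi] := proto_nonempty subS primS TgS i.
  have : tsupp (tile_tr T0 0) (q + (x - y0 + 0)) by rewrite T0x; exists q.
  by rewrite tile_tr0; exists (q + (x - y0 + 0)).
have [rP rPP] := repetitive_bound TgS finP legP PT0 T0_ne.
(* The control point of [T0]; hence [y + p0] is a control point whenever [P + y] occurs in the
   tiling. *)
pose p0 := x - y0 + a i.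
have [C [Phi PhiP]] := meyer_approximation r0 X_rd
  (control_points_fin subS primS TgS a) (control_pointsQ TgS pi_omega aQ)
  (control_points_repetitive subS primS TgS (a := a)) Q_exp dQ Q_conj Q_pisot rP.
pose vec (l : {ffun 'I_d -> 'I_n}) : 'rV[int]_d := \row_j ((l j).+1)%:R.
(* Colours are displacement indices, with [None] for points off the finite list. The list of copies
   comes first, then a lattice adapted to all their points. *)
have [ls lsP] := gallai (codom vec) (option C).
have [W Wu WP] := PhiP [seq p.1 + f *+ p.2 | p <- ls, f <- codom vec].
pose lat (t : 'rV[int]_d) : 'rV[R]_d := map_mx intr t *m W.
(* For every lattice point, an occurrence of [P] with the control point of [T0] within [rP] of
   it. *)
have /choice[y yP] : forall t, exists y, `|y - (lat t - p0)| <= rP /\ patch_tr P y `<=` Tg.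
  by move=> t; have [y y1 y2] := rPP (lat t - p0); exists y.
have /choice[c cP] : forall t, exists c : option C,
    t \in [seq p.1 + f *+ p.2 | p <- ls, f <- codom vec] ->
    exists2 tau, c = Some tau & y t = lat t + Phi tau - p0.
  move=> t; have [tin|tout] := boolP (t \in _); last by exists None.
  have [yt yPT] := yP t.
  have [||tau tauE] := WP t (y t + p0) tin.
  - exists i, (x - y0 + y t); split; last by rewrite /p0 addrCA addrA.
    by rewrite -T0x; apply: yPT; exact: patch_tr_mem.
  - by move: yt; rewrite opprB addrA.
  by exists (Some tau) => _; exists tau; rewrite // -tauE addrK.
have [[s k] /= sk [k0 [g gP]]] := lsP c.
have tin l : s + vec l *+ k \in [seq p.1 + f *+ p.2 | p <- ls, f <- codom vec].
  by apply/allpairsP; exists ((s, k), vec l); rewrite /= codom_f.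
have [tau gE] : exists tau, g = Some tau.
  pose l0 : {ffun 'I_d -> 'I_n} := [ffun=> Ordinal n0].
  by have [tau cE _] := cP _ (tin l0); exists tau; rewrite -cE gP // codom_f.
have yE l : y (s + vec l *+ k) = lat (s + vec l *+ k) + Phi tau - p0.
  have [tau' cE ->] := cP _ (tin l).
  by have := gP _ (codom_f vec l); rewrite cE gE => -[->].
(* Along the monochromatic copy [s + k {1,...,n}^d] all occurrences have the same displacement
   [Phi tau], so they differ by the grid spanned by [k] times the rows of [W]. *)
exists (fun j => k%:R *: row j W); split.
  have -> : \matrix_j (k%:R *: row j W) = k%:R *: W.
    by apply/matrixP => i' j; rewrite !mxE.
  by rewrite unitmxZ // unitfE pnatr_eq0 -lt0n.
exists (lat s + Phi tau - p0) => T1 [T2 [l [T PT <-]] <-].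
have -> : tile_tr (tile_tr T (\sum_j ((l j).+1)%:R *: (k%:R *: row j W))) (lat s + Phi tau - p0) =
    tile_tr T (y (s + vec l *+ k)).
  rewrite tile_trD yE; congr tile_tr.
  have -> : lat (s + vec l *+ k) = lat s + \sum_j ((l j).+1)%:R *: (k%:R *: row j W).
    rewrite /lat map_mxD mulmxDl [X in _ + X]mulmx_sum_row; congr (_ + _).
    apply: eq_bigr => j _; rewrite scalerA; congr (_ *: _).
    by rewrite mxE mulmxnE mxE raddfMn /= natz mulr_natr.
  by rewrite !addrA; congr (_ + _ + _); rewrite addrC.
have [_] := yP (s + vec l *+ k); apply; exact: patch_tr_mem.
Qed.
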